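(* Let $\mathbb{G}$ be a Green kernel of type $(s,\gamma)$ on $\Omega$ admitting a $\gamma$-normal derivative $D_\gamma\mathbb{G}$, and let $$u^\star(x)=\int_{\partial\Omega}D_\gamma\mathbb{G}(z,x)\,dz,\qquad x\in\Omega.$$ Then $$u^\star\asymp\begin{cases}\delta^{2s-\gamma-1} & \text{if }\gamma>s-\frac12,\\ \delta^\gamma\,(1+|\ln\delta|) & \text{if }\gamma=s-\frac12,\\ \delta^\gamma & \text{if }\gamma<s-\frac12,\end{cases}\qquad\text{in }\Omega.$$
   Context: $\Omega\subset\mathbb{R}^n$ ($n\ge1$) is a bounded domain with $C^{1,1}$ boundary and $\delta(x)=\mathrm{dist}(x,\partial\Omega)$. Write $a\wedge b=\min\{a,b\}$. For nonnegative functions, $f\asymp g$ on a set means that there is a constant $C>0$ with $C^{-1}g\le f\le Cg$ on that set. $dz$ on $\partial\Omega$ is surface measure (counting measure if $n=1$). Pointwise comparisons of $L^1_{loc}$ functions, such as $u^\star$, are understood a.e. A Green kernel of type $(s,\gamma)$ on $\Omega$, where $s,\gamma\in(0,1]$ and $2s\le n$, is a measurable function $\mathbb{G}:\Omega\times\Omega\to\mathbb{R}$ such that $\mathbb{G}(x,y)=\mathbb{G}(y,x)$ and $$\mathbb{G}(x,y)\asymp\frac{1}{|x-y|^{n-2s}}\Big(\frac{\delta(x)\delta(y)}{|x-y|^2}\wedge1\Big)^\gamma,\qquad x,y\in\Omega,\ x\ne y.$$ $\mathbb{G}$ admits a $\gamma$-normal derivative if there exists a (measurable) function $D_\gamma\mathbb{G}:\partial\Omega\times\Omega\to\mathbb{R}$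 such that for every $z\in\partial\Omega$ and every sequence $x_j\in\Omega$ with $x_j\to z$ one has $\lim_j\mathbb{G}(x_j,\cdot)/\delta(x_j)^\gamma=D_\gamma\mathbb{G}(z,\cdot)$ a.e. in $\Omega$. *)

(* Defs.v *)
From HB Require Import structures.
From mathcomp Require Import all_boot all_order all_algebra.
From mathcomp Require Import all_classical all_reals all_analysis.

Set Implicit Arguments.
Unset Strict Implicit.
Unset Printing Implicit Defensive.

Import Order.TTheory GRing.Theory Num.Theory.
Import numFieldNormedType.Exports.

Local Open Scope classical_set_scope.
Local Open Scope ring_scope.

(* Euclidean norm and distance on R^n. The canonical norm of 'rV[R]_n is the
   sup norm: it is used only for the topology and for boundedness. *)

Definition enorm (R : realType) (n : nat) (x : 'rV[R]_n) : R :=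
  Num.sqrt (\sum_i x ord0 i ^+ 2).

Definition boundary (T : topologicalType) (A : set T) : set T :=
  closure A `\` interior A.

Definition bdist (R : realType) (n : nat) (Omega : set 'rV[R]_n)
    (x : 'rV[R]_n) : R :=
  inf [set enorm (x - y) | y in boundary Omega].

(* Outer measure induced by countable coverings: the covering sets are the
   [cov i] for the admissible indices [P i], with weight [w i]. *)

Section CoverOuterMeasure.
Local Open Scope ereal_scope.
Variables (R : realType) (T I : Type).
Variables (P : set I) (cov : I -> set T) (w : I -> \bar R).

Definition cover_outer (A : set T) : \bar R :=
  ereal_inf [set \sum_(k <oo) w (F k) | F in
    [set F : nat -> I | (forall k, P (F k)) /\ A `<=` \bigcup_k cov (F k)]].

Hypothesis w_ge0 : forall i, P i -> 0 <= w i.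
Hypothesis w_null : exists2 i, P i & w i = 0.

Lemma cover_outer_ge0 A : 0 <= cover_outer A.
Proof.
apply: le_ereal_inf_tmp => _ [F [PF _] <-].
by apply: nneseries_ge0 => k _ _; exact/w_ge0/PF.
Qed.

Lemma cover_outer0 : cover_outer set0 = 0.
Proof.
apply/eqP; rewrite eq_le cover_outer_ge0 andbT.
have [i Pi wi0] := w_null.
apply: ereal_inf_lbound; exists (fun=> i); first by split.
by apply: eseries0 => k _ _; rewrite wi0.
Qed.

Lemma le_cover_outer : {homo cover_outer : A B / A `<=` B >-> A <= B}.
Proof.
move=> A B AB; apply/ereal_inf_le_tmp => _ [F [PF BF] <-].
by exists F => //; split=> //; exact: subset_trans BF.
Qed.

Lemma cover_outer_sigma_subadditive : sigma_subadditive cover_outer.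
Proof.
move=> A; have [[i ioo]|] := pselect (exists i, cover_outer (A i) = +oo).
  rewrite (eseries_pinfty _ _ ioo) ?leey// => n _.
  by rewrite -ltNye (lt_le_trans _ (cover_outer_ge0 _)).
rewrite -forallNE => Aoo.
suff add2e (e : {posnum R}) : cover_outer (\bigcup_n A n) <=
    \sum_(i <oo) cover_outer (A i) + e%:num%:E.
  by apply/lee_addgt0Pr => _/posnumP[].
rewrite (le_trans _ (epsilon_trick _ _ _))//; last first.
  by move=> n; exact: cover_outer_ge0.
pose Q n (F : nat -> I) :=
  ((forall k, P (F k)) /\ A n `<=` \bigcup_k cov (F k)) /\
  \sum_(k <oo) w (F k) <= cover_outer (A n) + (e%:num / (2 ^ n.+1)%:R)%:E.
have [G QG] : {G : nat -> nat -> I & forall n, Q n (G n)}.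
  apply: (@choice _ _ Q) => n.
  have en1 : (0 < e%:num / (2 ^ n.+1)%:R)%R by [].
  have fA : cover_outer (A n) \is a fin_num.
    by rewrite ge0_fin_numE ?cover_outer_ge0// ltey; apply/eqP/Aoo.
  have [x [F PF <-] xS] := lb_ereal_inf_adherent en1 fA.
  by exists F; split => //; exact/ltW.
have wG_ge0 i j : 0 <= w (G i j) by apply: w_ge0; exact: (QG i).1.1.
apply: (@le_trans _ _ (\sum_(i <oo) \sum_(j <oo) w (G i j))); last first.
  apply: lee_nneseries => [i _ _|n _]; last exact: (QG n).2.
  exact: nneseries_ge0.
have /card_esym/ppcard_eqP[f] := card_nat2.
apply: (@le_trans _ _ (\sum_(k <oo) w (G (f k).1 (f k).2))).
  apply: ereal_inf_lbound; exists (fun k => G (f k).1 (f k).2) => //.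
  split=> [k|t [i _ Ait]]; first exact: (QG (f k).1).1.1.
  have [j _ Gijt] := (QG i).1.2 t Ait.
  by exists (f^-1%FUN (i, j)) => //=; rewrite invK ?inE.
rewrite nneseries_esumT//.
rewrite -(@reindex_esum R _ _ setT setT f (fun ij => w (G ij.1 ij.2)))//.
rewrite nneseries_esumT//; last by move=> i; exact: nneseries_ge0.
rewrite (eq_esum (b := fun i => \esum_(j in [set: nat]) w (G i j))); last first.
  by move=> i _; rewrite nneseries_esumT.
rewrite esum_esum//.
by rewrite (_ : [set: nat] `*`` _ = setT)//; apply/seteqP; split.
Qed.

End CoverOuterMeasure.

(* Lebesgue measure on R^n: coverings by half-open boxes. The index [None]
   stands for the empty set, so that finite coverings are allowed (which is
   what makes the outer measure of set0 vanish when n = 0). *)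

Section Lebesgue.
Variables (R : realType) (n : nat).

Definition nonneg_box : set (option ('rV[R]_n * 'rV[R]_n)) :=
  [set o : option ('rV[R]_n * 'rV[R]_n) |
   if o is Some (a, b) then forall i, a ord0 i <= b ord0 i else True].

Definition box_set (o : option ('rV[R]_n * 'rV[R]_n)) : set 'rV[R]_n :=
  if o is Some (a, b)
  then [set x | forall i, a ord0 i < x ord0 i <= b ord0 i] else set0.

Definition box_vol (o : option ('rV[R]_n * 'rV[R]_n)) : \bar R :=
  if o is Some (a, b) then (\prod_i (b ord0 i - a ord0 i))%:E else 0%E.

Definition lebesgue_outer (A : set 'rV[R]_n) : \bar R :=
  cover_outer nonneg_box box_set box_vol A.

Lemma box_vol_ge0 o : nonneg_box o -> (0 <= box_vol o)%E.
Proof.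
case: o => [[a b] ab|//] /=; rewrite lee_fin.
by apply: prodr_ge0 => i _; rewrite subr_ge0.
Qed.

Lemma box_vol_null : exists2 o, nonneg_box o & box_vol o = 0%E.
Proof. by exists None. Qed.

HB.instance Definition _ := isOuterMeasure.Build R 'rV[R]_n lebesgue_outer
  (cover_outer0 box_set box_vol_ge0 box_vol_null)
  (cover_outer_ge0 box_set box_vol_ge0)
  (@le_cover_outer _ _ _ nonneg_box box_set box_vol)
  (cover_outer_sigma_subadditive box_set box_vol_ge0).

Definition lebesgue_outer_measure : {outer_measure set 'rV[R]_n -> \bar R} :=
  lebesgue_outer.

Definition lebesgueType := caratheodory_type lebesgue_outer_measure.

Definition lebesgue_n : {measure set lebesgueType -> \bar R} :=
  OuterMeasure.sort lebesgue_outer_measure : set lebesgueType -> \bar R.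

End Lebesgue.

(* d-dimensional Hausdorff measure on R^n, normalized as usual by the volume of
   the unit ball of R^d, so that it is the surface measure on d-dimensional
   C^1 submanifolds, and the counting measure if d = 0. *)

Section Hausdorff.
Variables (R : realType) (n d : nat).
Local Open Scope ereal_scope.

Definition diam (A : set 'rV[R]_n) : \bar R :=
  ereal_sup [set (enorm (p.1 - p.2))%:E | p in A `*` A].

Definition hausdorff_const : R :=
  (fine (lebesgue_outer [set x : 'rV[R]_d | (enorm x <= 1)%R]) / 2 ^+ d)%R.

Definition hausdorff_weight (A : set 'rV[R]_n) : \bar R :=
  if A == set0 then 0 else hausdorff_const%:E * diam A ^+ d.

Definition hausdorff_delta (delta : R) (A : set 'rV[R]_n) : \bar R :=
  cover_outer [set B | diam B <= delta%:E] id hausdorff_weight A.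

Definition hausdorff_outer (A : set 'rV[R]_n) : \bar R :=
  ereal_sup [set hausdorff_delta delta A | delta in [set e | (0 < e)%R]].

Lemma hausdorff_weight_ge0 A : 0 <= hausdorff_weight A.
Proof.
rewrite /hausdorff_weight; case: ifPn => [//|/set0P[x Ax]].
apply: mule_ge0.
  rewrite lee_fin; apply: divr_ge0; last by rewrite exprn_ge0.
  exact/fine_ge0/outer_measure_ge0.
apply: expe_ge0; apply: (@le_trans _ _ (enorm (x - x))%:E).
  by rewrite lee_fin sqrtr_ge0.
by apply: ereal_sup_ubound; exists (x, x).
Qed.

Lemma hausdorff_weight_null (delta : R) :
  exists2 A, diam A <= delta%:E & hausdorff_weight A = 0.
Proof.
exists set0; last by rewrite /hausdorff_weight eqxx.
by apply: ge_ereal_sup => y [p []].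
Qed.

Let wge0 (delta : R) (A : set 'rV[R]_n) :
  [set B | diam B <= delta%:E] A -> 0 <= hausdorff_weight A.
Proof. by move=> _; exact: hausdorff_weight_ge0. Qed.

Lemma hausdorff_outer_ge0 A : 0 <= hausdorff_outer A.
Proof.
apply: (@le_trans _ _ (hausdorff_delta 1 A)).
  exact: (cover_outer_ge0 id (@wge0 1%R)).
by apply: ereal_sup_ubound; exists 1%R => //=.
Qed.

Lemma hausdorff_outer0 : hausdorff_outer set0 = 0.
Proof.
apply/eqP; rewrite eq_le hausdorff_outer_ge0 andbT.
apply: ge_ereal_sup => _ [delta _ <-].
by rewrite /hausdorff_delta
  (cover_outer0 id (@wge0 delta) (hausdorff_weight_null delta)).
Qed.

Lemma le_hausdorff_outer : {homo hausdorff_outer : A B / A `<=` B >-> A <= B}.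
Proof.
move=> A B AB; apply: ge_ereal_sup => _ [delta d0 <-].
apply: (@le_trans _ _ (hausdorff_delta delta B)); first exact: le_cover_outer.
by apply: ereal_sup_ubound; exists delta.
Qed.

Lemma hausdorff_outer_sigma_subadditive : sigma_subadditive hausdorff_outer.
Proof.
move=> F; apply: ge_ereal_sup => _ [delta d0 <-].
apply: (@le_trans _ _ (\sum_(i <oo) hausdorff_delta delta (F i))).
  exact: (cover_outer_sigma_subadditive id (@wge0 delta)).
apply: lee_nneseries => [i _ _|i _].
  exact: (cover_outer_ge0 id (@wge0 delta)).
by apply: ereal_sup_ubound; exists delta.
Qed.

HB.instance Definition _ := isOuterMeasure.Build R 'rV[R]_n hausdorff_outer
  hausdorff_outer0 hausdorff_outer_ge0 le_hausdorff_outer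
  hausdorff_outer_sigma_subadditive.

Definition hausdorff_outer_measure : {outer_measure set 'rV[R]_n -> \bar R} :=
  hausdorff_outer.

Definition hausdorffType := caratheodory_type hausdorff_outer_measure.

Definition hausdorff_measure : {measure set hausdorffType -> \bar R} :=
  OuterMeasure.sort hausdorff_outer_measure : set hausdorffType -> \bar R.

End Hausdorff.

Arguments lebesgueType R n : clear implicits.
Arguments lebesgue_n R n : clear implicits.
Arguments hausdorffType R n d : clear implicits.
Arguments hausdorff_measure R n d : clear implicits.

Notation surface_measure R n := (hausdorff_measure R n n.-1).
Notation surfaceType R n := (hausdorffType R n n.-1).

(* Bounded domains with C^{1,1} boundary. *)

Definition bounded_domain (R : realType) (n : nat) (Omega : set 'rV[R]_n) :
    Prop :=
  [/\ Omega !=set0, open Omega, connected Omega & bounded_set Omega].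

Definition C11 (R : realType) (m : nat) (g : 'rV[R]_m -> R) : Prop :=
  (forall x, differentiable g x) /\
  exists L : R, forall x y v : 'rV[R]_m,
    `|'d g x v - 'd g y v| <= L * enorm (x - y) * enorm v.

(* Near each boundary point, in the orthonormal coordinates x *m Q, the domain
   lies above the graph of a C^{1,1} function of the coordinates other than
   the i-th one. *)
Definition C11_boundary (R : realType) (n : nat) (Omega : set 'rV[R]_n) :
    Prop :=
  forall z, boundary Omega z ->
  exists (r : R) (Q : 'M[R]_n) (i : 'I_n) (g : 'rV[R]_n.-1 -> R),
    [/\ 0 < r, Q *m Q^T = 1%:M, C11 g &
      forall x, enorm (x - z) < r ->
        (Omega x <-> g (col' i (x *m Q)) < (x *m Q) ord0 i)].

Definition comparable_on (R : realType) (T : Type) (A : set T) (f g : T -> R) :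
    Prop :=
  exists2 C : R, 0 < C & forall x, A x -> C^-1 * g x <= f x <= C * g x.

Definition ae_comparable_on (R : realType) (n : nat) (A : set 'rV[R]_n)
    (f : 'rV[R]_n -> \bar R) (g : 'rV[R]_n -> R) : Prop :=
  exists2 C : R, 0 < C &
    {ae lebesgue_n R n, forall x, A x ->
      ((C^-1 * g x)%:E <= f x <= (C * g x)%:E)%E}.

Definition green_bound (R : realType) (n : nat) (Omega : set 'rV[R]_n)
    (s gamma : R) (x y : 'rV[R]_n) : R :=
  (enorm (x - y) `^ (n%:R - 2 * s))^-1 *
  (Num.min (bdist Omega x * bdist Omega y / enorm (x - y) ^+ 2) 1) `^ gamma.

Record green_kernel (R : realType) (n : nat) (Omega : set 'rV[R]_n)
    (s gamma : R) (G : 'rV[R]_n -> 'rV[R]_n -> R) : Prop := GreenKernel {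
  green_measurable : measurable_fun
    (Omega `*` Omega : set (lebesgueType R n * lebesgueType R n))
    (fun p => G p.1 p.2) ;
  green_sym : forall x y, Omega x -> Omega y -> G x y = G y x ;
  green_comparable : comparable_on
    [set p | [/\ Omega p.1, Omega p.2 & p.1 != p.2]]
    (fun p => G p.1 p.2) (fun p => green_bound Omega s gamma p.1 p.2) }.

(* D plays the role of D_gamma G; only its values on boundary x domain
   matter. *)
Record normal_derivative (R : realType) (n : nat) (Omega : set 'rV[R]_n)
    (gamma : R) (G D : 'rV[R]_n -> 'rV[R]_n -> R) : Prop := NormalDerivative {
  normal_derivative_measurable : measurable_fun
    (boundary Omega `*` Omega : set (surfaceType R n * lebesgueType R n))
    (fun p => D p.1 p.2) ;
  normal_derivative_cvg : forall (z : 'rV[R]_n) (x : nat -> 'rV[R]_n),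
    boundary Omega z -> (forall j, Omega (x j)) -> x @ \oo --> z ->
    {ae lebesgue_n R n, forall y, Omega y ->
      G (x j) y / bdist Omega (x j) `^ gamma @[j --> \oo] --> D z y} }.

Definition u_star (R : realType) (n : nat) (Omega : set 'rV[R]_n)
    (D : 'rV[R]_n -> 'rV[R]_n -> R) (x : 'rV[R]_n) : \bar R :=
  (\int[surface_measure R n]_(z in boundary Omega) (D z x)%:E)%E.

Definition u_star_rate (R : realType) (n : nat) (Omega : set 'rV[R]_n)
    (s gamma : R) (x : 'rV[R]_n) : R :=
  if s - 2^-1 < gamma then bdist Omega x `^ (2 * s - gamma - 1)
  else if gamma == s - 2^-1
  then bdist Omega x `^ gamma * (1 + `|ln (bdist Omega x)|)
  else bdist Omega x `^ gamma.

(* Main.v *)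
(** Write [d = n - 1], [p = n - 2 s + 2 gamma] and [b = p - d]. Letting [x_j]
    tend to a boundary point [z] in the two-sided bound for the Green kernel,
    where the minimum is eventually its first argument, shows that [D z x] is
    comparable to [delta x ^ gamma / |x - z| ^ p] for almost every [x], for
    each [z]; by Tonelli this holds for almost every [x] at almost every [z].
    The boundary is locally a Lipschitz graph, hence Ahlfors regular: balls of
    radius [t] centred on it have surface measure comparable to [t ^ d].
    Since [|x - z| ^ (- p)] is comparable to the sum of [t ^ (- p)] over the
    dyadic multiples [t = 2 ^ k delta x] larger than [|x - z|], its surface
    integral is comparable to the sum of the [t ^ (- b)] over those [t] up to
    the diameter of the domain, a geometric sum whose size depends on the sign
    of [b]. *)

Require Import Defs.
From mathcomp Require Import all_boot all_order all_algebra finmap.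
From mathcomp Require Import all_classical all_reals all_analysis.
From mathcomp Require Import measurable_realfun.
From mathcomp Require Import ring lra zify.

Set Implicit Arguments.
Unset Strict Implicit.
Unset Printing Implicit Defensive.

Import Order.TTheory GRing.Theory Num.Theory.
Import numFieldNormedType.Exports.

Local Open Scope classical_set_scope.
Local Open Scope ring_scope.

(** * Euclidean norm *)

(** The boundary is never parametrized for integration: the dyadic sum of indicators reduces the
    surface integral to finitely many measures of balls, for which crude constants suffice. From
    above, a piece of boundary is a Lipschitz image of a cube, cut into small cells. From below, it
    is projected to [R^d], where enclosing each covering set in a cube costs a factor [2 ^ d] and
    the volume of a box bounds the total.

    Two measure-theoretic obstacles shape the rest. Measurability refers to the Carathéodory
    sigma-algebras of the two outer measures, so open sets must first be shown to belong to them;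
    half-spaces suffice, by additivity on separated sets for Hausdorff measure and by cutting boxes
    for Lebesgue measure. And the exceptional null set of the limit defining [D z] depends on [z];
    exchanging the two variables requires sigma-finite measures, hence the proof that the boundary
    has finite surface measure and the restriction of both measures.

    For [n = 1] the same arguments run with [d = 0]: the empty product gives the only nonempty box
    of [R^0] volume 1. *)

Section EuclideanNorm.
Variables (R : realType) (n : nat).
Implicit Types x y z : 'rV[R]_n.

Lemma enorm_ge0 x : 0 <= enorm x.
Proof. exact: sqrtr_ge0. Qed.

Lemma sqr_enorm x : enorm x ^+ 2 = \sum_i x ord0 i ^+ 2.
Proof. by rewrite sqr_sqrtr// sumr_ge0// => i _; exact: sqr_ge0. Qed.

Lemma enorm0 : enorm (0 : 'rV[R]_n) = 0.
Proof.
by rewrite /enorm big1 ?sqrtr0// => i _; rewrite mxE expr0n.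
Qed.

Lemma enormN x : enorm (- x) = enorm x.
Proof.
by rewrite /enorm; congr Num.sqrt; apply: eq_bigr => i _; rewrite mxE sqrrN.
Qed.

Lemma enormBC x y : enorm (x - y) = enorm (y - x).
Proof. by rewrite -enormN opprB. Qed.

Lemma cauchy_schwarz_sum x y :
  \sum_i x ord0 i * y ord0 i <= enorm x * enorm y.
Proof.
have [xy0|xy0] := leP (\sum_i x ord0 i * y ord0 i) 0.
  by rewrite (le_trans xy0)// mulr_ge0// enorm_ge0.
rewrite -(@ler_pXn2r _ 2)// ?nnegrE ?mulr_ge0 ?enorm_ge0//; last exact: ltW.
rewrite exprMn !sqr_enorm.
(* Lagrange's identity: this sum of squared minors is twice the gap in the squared inequality. *)
have : 0 <= \sum_i \sum_j (x ord0 i * y ord0 j - x ord0 j * y ord0 i) ^+ 2.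
  by apply: sumr_ge0 => i _; apply: sumr_ge0 => j _; exact: sqr_ge0.
have -> : \sum_i \sum_j (x ord0 i * y ord0 j - x ord0 j * y ord0 i) ^+ 2 =
    ((\sum_i x ord0 i ^+ 2) * (\sum_i y ord0 i ^+ 2) -
     (\sum_i x ord0 i * y ord0 i) ^+ 2) *+ 2.
  have E (f g : 'I_n -> R) :
      (\sum_i f i) * (\sum_i g i) = \sum_i \sum_j f i * g j.
    by rewrite mulr_suml; apply: eq_bigr => i _; rewrite mulr_sumr.
  rewrite expr2 !E mulrnBl mulr2n [X in _ + X - _]exchange_big/=.
  rewrite -sumrMnl -big_split -sumrB/=; apply: eq_bigr => i _.
  rewrite -sumrMnl -big_split -sumrB/=; apply: eq_bigr => j _.
  by ring.
by rewrite pmulrn_lge0// subr_ge0.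
Qed.

Lemma enormD x y : enorm (x + y) <= enorm x + enorm y.
Proof.
rewrite -(@ler_pXn2r _ 2)// ?nnegrE ?addr_ge0 ?enorm_ge0//.
rewrite sqrrD !sqr_enorm.
have -> : \sum_i (x + y) ord0 i ^+ 2 = \sum_i x ord0 i ^+ 2 +
    (\sum_i x ord0 i * y ord0 i) *+ 2 + \sum_i y ord0 i ^+ 2.
  rewrite -sumrMnl -!big_split/=; apply: eq_bigr => i _.
  by rewrite mxE sqrrD.
by rewrite lerD2r lerD2l lerMn2r cauchy_schwarz_sum.
Qed.

Lemma enormB x y z : enorm (x - z) <= enorm (x - y) + enorm (y - z).
Proof. by rewrite -[x - z](@subrKA _ y) enormD. Qed.

Lemma coord_le_enorm x i : `|x ord0 i| <= enorm x.
Proof.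
rewrite -(@ler_pXn2r _ 2)// ?nnegrE ?enorm_ge0//.
rewrite sqr_enorm real_normK ?num_real// (bigD1 i)//= lerDl.
by apply: sumr_ge0 => j _; exact: sqr_ge0.
Qed.

Lemma norm_coord_le x i : `|x ord0 i| <= `|x|.
Proof.
have -> : `|x| = mx_norm x by [].
by rewrite mx_normrE; apply: (le_bigmax _ _ (ord0, i)).
Qed.

Lemma norm_le_enorm x : `|x| <= enorm x.
Proof.
have -> : `|x| = mx_norm x by [].
rewrite mx_normrE; apply/bigmax_leP; split=> [|[i j] _]; first exact: enorm_ge0.
by rewrite ord1 coord_le_enorm.
Qed.

Lemma enorm_le_sum x : enorm x <= \sum_i `|x ord0 i|.
Proof.
rewrite -(@ler_pXn2r _ 2)// ?nnegrE ?enorm_ge0 ?sumr_ge0//.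
rewrite sqr_enorm expr2 mulr_suml; apply: ler_sum => i _.
rewrite -(real_normK (num_real (x ord0 i))) expr2 ler_wpM2l//.
by rewrite (bigD1 i)//= lerDl sumr_ge0.
Qed.

Lemma enorm_le_norm x : enorm x <= n%:R * `|x|.
Proof.
apply: (le_trans (enorm_le_sum x)).
rewrite mulr_natl -[X in _ *+ X]card_ord -sumr_const; apply: ler_sum => i _.
exact: norm_coord_le.
Qed.

Lemma enorm_eq0 x : (enorm x == 0) = (x == 0).
Proof.
apply/idP/eqP => [/eqP x0|->]; last by rewrite enorm0.
apply/rowP => i; rewrite mxE; apply/normr0_eq0/le_anti.
by rewrite normr_ge0 andbT -x0 coord_le_enorm.
Qed.

Lemma enorm_gt0 x : (0 < enorm x) = (x != 0).
Proof. by rewrite lt0r enorm_eq0 enorm_ge0 andbT. Qed.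

End EuclideanNorm.

(** * Measurable sets for the Hausdorff and Lebesgue outer measures *)

(* Carathéodory's criterion: the pieces of [X] lying in the successive slabs
   [c + 1/(k+3) < f <= c + 1/(k+2)] have a finite total measure, because two
   slabs whose indices have the same parity are separated. *)
Lemma caratheodory_sublevel (R : realType) (T : Type)
    (mu : {outer_measure set T -> \bar R}) (f : T -> R) (c : R) :
  (forall (A B : set T) (e : R), 0 < e ->
    (forall x y, A x -> B y -> f x + e <= f y) ->
    (mu A + mu B <= mu (A `|` B))%E) ->
  mu.-caratheodory [set x | f x <= c].
Proof.
move=> sep; apply: le_caratheodory_measurable => X.
pose L := [set x | f x <= c].
have [->|Xoo] := eqVneq (mu X) +oo%E; first by rewrite leey.
pose a k : R := k.+1%:R^-1.
have a_gt0 k : 0 < a k by rewrite invr_gt0.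
have aS k : a k.+1 < a k by rewrite ltf_pV2 ?posrE// ltr_nat.
pose slab k := X `&` [set x | c + a k.+2 < f x <= c + a k.+1].
pose above k := X `&` [set x | c + a k < f x].
(* [b] selects a parity. The slab of index [2 * m + b] stays below [c + a (2 * m + b).+1], strictly
   under the threshold of [above (2 * m + b)], which contains the earlier slabs of that parity. *)
have slabs b m :
    (\sum_(k < m) mu (slab (2 * k + b)%N) <= mu (above (2 * m + b)%N))%E.
  elim: m => [|m IH]; first by rewrite big_ord0 outer_measure_ge0.
  rewrite big_ord_recr/=; apply: (le_trans (leeD2r _ IH)).
  rewrite addeC; apply: (le_trans (sep _ _ (a (2 * m + b)%N - a (2 * m + b).+1)
    _ _)).
  - by rewrite subr_gt0.
  - move=> x y [_ /andP[_ xa]] [_ ya]; rewrite /= in xa ya.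
    by move: xa ya; lra.
  - have -> : (2 * m.+1 + b = (2 * m + b).+2)%N by lia.
    apply: le_outer_measure => x [[Xx /andP[? _]]|[Xx /= fx]]; split=> //=.
    by apply: lt_trans fx; rewrite ltrD2l (lt_trans (aS _)).
have slabs_fin : (\sum_(0 <= k <oo) mu (slab k) <= mu X + mu X)%E.
  apply: lime_le.
    by apply: is_cvg_nneseries => k _ _; exact: outer_measure_ge0.
  apply: nearW => m.
  apply: (@le_trans _ _ (\sum_(0 <= k < 2 * m) mu (slab k))%E).
    apply: lee_sum_nneg_natr => [k _ _|]; first exact: outer_measure_ge0.
    by lia.
  have -> : (\sum_(0 <= k < 2 * m) mu (slab k) =
      \sum_(k < m) mu (slab (2 * k + 0)%N) +
      \sum_(k < m) mu (slab (2 * k + 1)%N))%E.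
    elim: m => [|m IH]; first by rewrite muln0 big_geq// !big_ord0 adde0.
    rewrite mulnS !addSn add0n big_nat_recr//= big_nat_recr//= IH
      !big_ord_recr/=.
    by rewrite addn0 addn1 -!addeA; congr (_ + _)%E; rewrite addeCA.
  by apply: leeD; apply: (le_trans (slabs _ _)); apply: le_outer_measure;
    exact: subIsetl.
have tail_cvg : (\sum_(N <= k <oo) mu (slab k) @[N --> \oo] --> 0)%E.
  apply: nneseries_tail_cvg; last by move=> k _; exact: outer_measure_ge0.
  apply: (le_lt_trans slabs_fin).
  by rewrite -ge0_fin_numE ?adde_ge0 ?outer_measure_ge0// fin_numD andbb
    ge0_fin_numE ?outer_measure_ge0// ltey.
have Xfin : mu X \is a fin_num.
  by rewrite ge0_fin_numE ?outer_measure_ge0// ltey.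
(* Outside [L], the set [X] consists of [above N.+1], separated from [L] by the gap [a N.+1], and of
   the slabs of index at least [N], whose total measure tends to 0. *)
have step (N : nat) : (mu (X `&` L) + mu (X `&` ~` L) <=
    mu X + \sum_(N <= k <oo) mu (slab k))%E.
  have : (mu (X `&` ~` L) <=
      mu (above N.+1) + \sum_(N <= k <oo) mu (slab k))%E.
    apply: (@le_trans _ _ (mu (above N.+1 `|` \bigcup_k slab (k + N)%N))).
      apply: le_outer_measure => x [Xx /=/negP]; rewrite -ltNge => cx.
      have [fxN|?] := leP (f x) (c + a N.+1); [right|by left; split].
      have exk : exists k, c + a k.+2 < f x.
        have [k] := ltr_add_invr cx; rewrite -/(a k) => fk.
        by exists k; move: (aS k) (aS k.+1) fk; lra.
      (* The least index determines the slab of [x]: its upper bound follows from minimality, or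
         from [fxN] when [k = N]. *)
      have := ex_minnP exk => -[k fk kmin].
      have adec i j : (i <= j)%N -> a j <= a i.
        by move=> ij; rewrite lef_pV2 ?posrE// ler_nat.
      have Nk : (N <= k)%N.
        rewrite leqNgt; apply/negP => kN.
        by have := adec k.+2 N.+1 kN; move: fk fxN; lra.
      exists (k - N)%N => //; rewrite subnK//; split=> //=; rewrite fk/=.
      move: Nk; rewrite leq_eqVlt => /predU1P[<-//|Nk].
      rewrite leNgt; apply/negP; case: k => // k in fk kmin Nk * => /kmin.
      by rewrite ltnn.
    apply: (le_trans (outer_measureU2 _ _ _)); apply: leeD2l.
    apply: (le_trans (outer_measure_sigma_subadditive _ _)).
    rewrite -(@nneseries_addn _ (mu \o slab))// => k.
    exact: outer_measure_ge0.
  move=> /(leeD2l (mu (X `&` L))) /le_trans; apply.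
  rewrite addeA; apply: leeD2r.
  apply: (le_trans (sep _ _ (a N.+1) _ _)) => //.
    by move=> x y [_]; rewrite /L/= => xc [_ /= cy]; lra.
  by apply: le_outer_measure; rewrite subUset; split; exact: subIsetl.
have : (mu X + \sum_(N <= k <oo) mu (slab k) @[N --> \oo] --> mu X + 0)%E.
  by apply: cvgeD => //; [rewrite fin_num_adde_defl|exact: cvg_cst].
rewrite adde0 => Xcvg.
rewrite -(cvg_lim _ Xcvg)//; apply: lime_ge; first by apply/cvg_ex; eexists;
  exact: Xcvg.
exact: nearW.
Qed.

(** A cover of the union yields one cover of each set, at no extra weight. This applies to both
    measures: for Hausdorff measure one of the two pieces is empty, for Lebesgue measure a box is
    cut by a hyperplane. *)
Lemma cover_outer_split (R : realType) (T I : Type) (P : set I)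
    (cov : I -> set T) (w : I -> \bar R) (l r : I -> I) (A B : set T) :
  (forall i, P i -> [/\ P (l i), P (r i), (0 <= w (l i))%E, (0 <= w (r i))%E &
    (w (l i) + w (r i) <= w i)%E]) ->
  (forall i, P i -> A `&` cov i `<=` cov (l i)) ->
  (forall i, P i -> B `&` cov i `<=` cov (r i)) ->
  (cover_outer P cov w A + cover_outer P cov w B <=
   cover_outer P cov w (A `|` B))%E.
Proof.
move=> lr lA rB; apply: le_ereal_inf_tmp => _ [F [PF ABF] <-].
apply: (@le_trans _ _
  (\sum_(k <oo) w (l (F k)) + \sum_(k <oo) w (r (F k)))%E); last first.
  rewrite -nneseriesD; last 2 first.
    by move=> k _ _; have [] := lr _ (PF k).
    by move=> k _ _; have [] := lr _ (PF k).
  apply: lee_nneseries => [k _ _|k _]; last by have [] := lr _ (PF k).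
  by have [_ _ ? ? _] := lr _ (PF k); exact: adde_ge0.
apply: leeD; apply: ereal_inf_lbound.
- exists (fun k => l (F k)) => //; split=> [k|x Ax].
    by have [] := lr _ (PF k).
  by have [|k _ Fx] := ABF x; [left|exists k => //; exact: lA].
- exists (fun k => r (F k)) => //; split=> [k|x Bx].
    by have [] := lr _ (PF k).
  by have [|k _ Fx] := ABF x; [right|exists k => //; exact: rB].
Qed.

Section MeasurableSets.
Variables (R : realType) (n : nat).
Implicit Types mu : {outer_measure set 'rV[R]_n -> \bar R}.

Lemma le_diam (A : set 'rV[R]_n) x y :
  A x -> A y -> ((enorm (x - y))%:E <= diam A)%E.
Proof. by move=> Ax Ay; apply: ereal_sup_ubound; exists (x, y). Qed.

(** A set of diameter at most [delta < e] cannot meet both [A] and [B], so each covering set is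
    assigned whole to one of them. *)
Lemma hausdorff_delta_separated d (A B : set 'rV[R]_n) (e delta : R) :
  delta < e -> (forall x y, A x -> B y -> e <= enorm (x - y)) ->
  (hausdorff_delta d delta A + hausdorff_delta d delta B <=
   hausdorff_delta d delta (A `|` B))%E.
Proof.
move=> de AB.
pose l (C : set 'rV[R]_n) := if `[< C `&` A !=set0 >] then C else set0.
pose r (C : set 'rV[R]_n) := if `[< C `&` A !=set0 >] then set0 else C.
have w0 : hausdorff_weight d (set0 : set 'rV[R]_n) = 0%E.
  by rewrite /hausdorff_weight eqxx.
have d0 : (diam (set0 : set 'rV[R]_n) <= delta%:E)%E.
  by apply: ge_ereal_sup => y [p []].
apply: (@cover_outer_split _ _ _ _ _ _ l r) => C /= dC.
- by rewrite /l /r; case: ifP => _; rewrite ?w0 ?adde0 ?add0e;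
    split=> //; exact: hausdorff_weight_ge0.
- by move=> x [Ax Cx]; rewrite /l asboolT//; exists x.
- move=> y [By Cy]; rewrite /r asboolF// => -[x [Cx Ax]].
  have := le_trans (le_diam Cx Cy) dC; rewrite lee_fin.
  by have := AB x y Ax By; lra.
Qed.

(** [hausdorff_delta] grows as the scale shrinks, so the scale [d3] can be nearly optimal for [A]
    and for [B] at once while lying below [e]. *)
Lemma hausdorff_outer_separated d (A B : set 'rV[R]_n) (e : R) : 0 < e ->
  (forall x y, A x -> B y -> e <= enorm (x - y)) ->
  (hausdorff_outer d A + hausdorff_outer d B <= hausdorff_outer d (A `|` B))%E.
Proof.
move=> e0 AB.
have anti (C : set 'rV[R]_n) (d1 d2 : R) : d1 <= d2 ->
    (hausdorff_delta d d2 C <= hausdorff_delta d d1 C)%E.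
  move=> d12; apply: ereal_inf_le_tmp => _ [F [PF CF] <-]; exists F => //.
  by split=> // k; apply: (le_trans (PF k)); rewrite lee_fin.
have [->|ABoo] := eqVneq (hausdorff_outer d (A `|` B)) +oo%E;
  first by rewrite leey.
have fin (C : set 'rV[R]_n) :
    C `<=` A `|` B -> hausdorff_outer d C \is a fin_num.
  move=> CAB; rewrite ge0_fin_numE ?hausdorff_outer_ge0//.
  by apply: (le_lt_trans (le_hausdorff_outer d CAB)); rewrite ltey.
have finA := fin A (@subsetUl _ _ _).
have finB := fin B (@subsetUr _ _ _).
apply/lee_addgt0Pr => eps eps0.
have eps2 : 0 < eps / 2 by lra.
have [_ [d1 /= d10 <-] d1A] := ub_ereal_sup_adherent eps2 finA.
have [_ [d2 /= d20 <-] d2B] := ub_ereal_sup_adherent eps2 finB.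
pose d3 := Num.min (Num.min d1 d2) (e / 2).
have d30 : 0 < d3 by rewrite !lt_min d10 d20 divr_gt0.
have d3e : d3 < e by rewrite gt_min; apply/orP; right; lra.
have : (hausdorff_outer d A + hausdorff_outer d B - eps%:E <=
    hausdorff_outer d (A `|` B))%E.
  apply: (@le_trans _ _ (hausdorff_delta d d3 A + hausdorff_delta d d3 B)%E).
    have -> : (hausdorff_outer d A + hausdorff_outer d B - eps%:E =
        (hausdorff_outer d A - (eps / 2)%:E) +
        (hausdorff_outer d B - (eps / 2)%:E))%E.
      by rewrite -(fineK finA) -(fineK finB) -!EFinN -!EFinD; congr EFin; lra.
    apply: leeD; apply: ltW.
      by apply: (lt_le_trans d1A); apply: anti; rewrite !ge_min lexx.
    by apply: (lt_le_trans d2B); apply: anti; rewrite !ge_min lexx orbT.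
  apply: (le_trans (hausdorff_delta_separated d d3e AB)).
  by apply: ereal_sup_ubound; exists d3.
by rewrite leeBlDr.
Qed.

Lemma hausdorff_halfspace d i (c : R) :
  (hausdorff_outer_measure R n d).-caratheodory [set x | x ord0 i <= c].
Proof.
apply: caratheodory_sublevel => A B e e0 AB.
apply: (hausdorff_outer_separated d e0) => x y Ax By.
have := le_trans (ler_norm _) (coord_le_enorm (y - x) i).
by rewrite !mxE -enormBC; have := AB x y Ax By; lra.
Qed.

(** The boxes of a cover may be large, so separation of sets gives nothing here. Each box is cut
    along the hyperplane instead; half-open sides make the two pieces fit exactly. *)
Lemma lebesgue_halfspace i (c : R) :
  (lebesgue_outer_measure R n).-caratheodory [set x | x ord0 i <= c].
Proof.
apply: le_caratheodory_measurable => X.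
pose upd (v : 'rV[R]_n) t : 'rV[R]_n := \row_j (if j == i then t else v ord0 j).
(* The level [c] clamped to the [i]-th side of the box: if the hyperplane misses the box, one piece
   degenerates to volume 0. *)
pose cut (a b : 'rV[R]_n) := Num.max (a ord0 i) (Num.min c (b ord0 i)).
pose l (o : option ('rV[R]_n * 'rV[R]_n)) :=
  if o is Some (a, b) then Some (a, upd b (cut a b)) else None.
pose r (o : option ('rV[R]_n * 'rV[R]_n)) :=
  if o is Some (a, b) then Some (upd a (cut a b), b) else None.
rewrite [leRHS](_ : _ = lebesgue_outer_measure R n
    ((X `&` [set x | x ord0 i <= c]) `|` (X `&` ~` [set x | x ord0 i <= c])));
  last by rewrite -setIUr setUv setIT.
apply: (@cover_outer_split _ _ _ _ _ _ l r).
- move=> [[a b]|] /=; last by move=> _; rewrite adde0.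
  move=> ab.
  have cut1 : a ord0 i <= cut a b by rewrite le_max lexx.
  have cut2 : cut a b <= b ord0 i by rewrite ge_max ab ge_min lexx orbT.
  have lb j : a ord0 j <= upd b (cut a b) ord0 j.
    by rewrite mxE; case: eqP => [->|].
  have rb j : upd a (cut a b) ord0 j <= b ord0 j.
    by rewrite mxE; case: eqP => [->|].
  split => //.
  + by rewrite lee_fin; apply: prodr_ge0 => j _; rewrite subr_ge0.
  + by rewrite lee_fin; apply: prodr_ge0 => j _; rewrite subr_ge0.
  + rewrite -EFinD lee_fin (bigD1 i)//= [X in _ + X](bigD1 i)//= [leRHS](bigD1
    i)//=.
    rewrite !mxE eqxx.
    rewrite (eq_bigr (fun j => b ord0 j - a ord0 j)); last first.
      by move=> j /negPf ji; rewrite mxE ji.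
    rewrite [X in _ + _ * X](eq_bigr (fun j => b ord0 j - a ord0 j));
      last first.
      by move=> j /negPf ji; rewrite mxE ji.
    by rewrite -mulrDl [cut a b - _ + _]addrC subrKA.
- move=> [[a b]|] /= ab x [[Xx xc]]//= xab j.
  rewrite mxE; case: eqP => [->|_]//.
  have /andP[-> xb] := xab i.
  by rewrite le_max le_min xb xc orbT.
- move=> [[a b]|] /= ab x [[Xx /negP]]//=; rewrite -ltNge => xc xab j.
  rewrite mxE; case: eqP => [->|_]//.
  have /andP[xa ->] := xab i.
  by rewrite gt_max xa gt_min xc.
Qed.

(** An open set is a countable union of half-open cubes with rational centre and radius, each a
    finite intersection of differences of half-spaces. *)
Lemma open_caratheodory mu (U : set 'rV[R]_n) :
  (forall i c, mu.-caratheodory [set x : 'rV[R]_n | x ord0 i <= c]) ->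
  open U -> mu.-caratheodory U.
Proof.
move=> half oU.
have meas (S : set 'rV[R]_n) : mu.-caratheodory S =
    measurable (S : set (caratheodory_type mu)) by [].
pose cube (q : 'rV[rat]_n * rat) : set 'rV[R]_n :=
  [set x | forall i,
    ratr (q.1 ord0 i) - ratr q.2 < x ord0 i <= ratr (q.1 ord0 i) + ratr q.2].
have mcube q : mu.-caratheodory (cube q).
  rewrite meas (_ : cube q = \bigcap_(i in [set: 'I_n])
    ([set x | x ord0 i <= ratr (q.1 ord0 i) + ratr q.2] `\`
     [set x | x ord0 i <= ratr (q.1 ord0 i) - ratr q.2])).
    apply: fin_bigcap_measurable => // i _; apply: measurableD; exact: half.
  apply/seteqP; split=> [x qx i _|x qx i].
    have /andP[xl xr] := qx i; split=> //=; apply/negP; by rewrite -ltNge.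
  by have [/= -> /negP] := qx i I; rewrite -ltNge => ->.
have -> : U = \bigcup_(q in [set q | cube q `<=` U]) cube q.
  apply/seteqP; split=> [x Ux|x [q qU qx]]; last exact: qU.
  have /nbhs_ballP[e /= e0 xe] : nbhs x U by exact: open_nbhs_nbhs.
  have [r r0 re] : exists2 r : rat, (0 : R) < ratr r & (ratr r : R) < e / 2.
    have [|r] := @rat_in_itvoo R 0 (e / 2); first by lra.
    by rewrite in_itv/= => /andP[? ?]; exists r.
  have /choice[q qx] : forall i, exists q : rat,
      (x ord0 i - ratr r < (ratr q : R) < x ord0 i + ratr r).
    move=> i; have [|q] := @rat_in_itvoo R (x ord0 i - ratr r) (x ord0 i + ratr
      r).
      by lra.
    by rewrite in_itv/= => ?; exists q.
  exists (\row_i q i, r) => [y /= qy|i /=].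
    apply: xe; split=> // j i; rewrite ord1; have := qy i; have := qx i;
      rewrite mxE.
    move=> /andP[? ?] /andP[? ?]; rewrite /ball/= ltr_distl; apply/andP;
      split; lra.
  have := qx i; rewrite mxE.
  by move=> /andP[? ?]; apply/andP; split; lra.
rewrite meas bigcup_mkcond; apply: countable_bigcupT_measurable => [|q].
  exact: countableP.
by case: ifP => _; [exact: mcube|exact: measurable0].
Qed.

End MeasurableSets.

Section MeasurableFunctions.
Variables (R : realType) (n : nat).
Variable mu : {outer_measure set 'rV[R]_n -> \bar R}.
Hypothesis half :
  forall i c, mu.-caratheodory [set x : 'rV[R]_n | x ord0 i <= c].

Lemma continuous_caratheodory_measurable (f : 'rV[R]_n -> R) :
  continuous f ->
  measurable_fun (setT : set (caratheodory_type mu)) f.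
Proof.
move=> /continuousP cf.
apply: (measurability _ (measurable_realfun.RGenOpens.measurableE R)).
move=> _ [_ [a [b ->] <-]]; rewrite setTI.
apply: open_caratheodory => //; exact/cf/interval_open.
Qed.

End MeasurableFunctions.

(** * Lebesgue outer measure of a box *)

(* Slicing the boxes along the first coordinate reduces the statement to the
   lower dimension, through the integral of a series on the real line. *)
Lemma box_cover_vol (R : realType) (n : nat) (a b : 'rV[R]_n)
    (F : nat -> option ('rV[R]_n * 'rV[R]_n)) :
  (forall i, a ord0 i <= b ord0 i) -> (forall k, nonneg_box (F k)) ->
  box_set (Some (a, b)) `<=` \bigcup_k box_set (F k) ->
  (box_vol (Some (a, b)) <= \sum_(k <oo) box_vol (F k))%E.
Proof.
elim: n a b F => [|n IH] a b F ab F0 abF.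
  (* In dimension 0 a box is the single point, of volume 1 as an empty product; some member of the
     cover must then be a box rather than [None]. *)
  have [|k _] := abF a; first by case.
  case Fk: (F k) => [[u v]|//] _.
  rewrite (nneseriesD1 (n := k))//; last by move=> j _; exact: box_vol_ge0.
  rewrite Fk /= !big_ord0 leeDl// nneseries_ge0// => j _ _; exact: box_vol_ge0.
pose tail (v : 'rV[R]_n.+1) : 'rV[R]_n := \row_i v ord0 (lift ord0 i).
(* A box that misses height [t] becomes [None], so the slice has volume [V k] times the indicator of
   [I k] at [t]. *)
pose slice k t := if F k is Some (u, v) then
  if u ord0 ord0 < t <= v ord0 ord0 then Some (tail u, tail v) else None
  else None.
pose I k := if F k is Some (u, v) then `]u ord0 ord0, v ord0 ord0]%classic
  else set0.
pose V k : R := if F k is Some (u, v)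
  then \prod_i (tail v ord0 i - tail u ord0 i) else 0.
have V0 k : 0 <= V k.
  rewrite /V; have := F0 k; case: (F k) => [[u v]|//] /= uv.
  by apply: prodr_ge0 => i _; rewrite !mxE subr_ge0.
have mI k : measurable (I k : set (measurableTypeR R)).
  rewrite /I; case: (F k) => [[u v]|];
    [exact: measurable_itv|exact: measurable0].
have sliceE k t : box_vol (slice k t) = ((V k)%:E * (\1_(I k) t)%:E)%E.
  rewrite /slice /V /I; case: (F k) => [[u v]|]; last by rewrite mul0e.
  rewrite indicE; case: ifPn => uvt.
    by rewrite mem_set ?mule1//=; rewrite in_itv.
  by rewrite memNset ?mule0//= in_itv/=; exact/negP.
have slice_cover t : a ord0 ord0 < t <= b ord0 ord0 ->
    (box_vol (Some (tail a, tail b)) <= \sum_(k <oo) box_vol (slice k t))%E.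
  move=> abt; apply: IH => [i|k|x xab].
  - by rewrite !mxE.
  - rewrite /slice; have := F0 k; case: (F k) => [[u v]|//] uv.
    by case: ifP => //= _ i; rewrite !mxE.
  - have [i|k _ Fk] := abF (\row_i (if unlift ord0 i is Some j then x ord0 j
    else t)).
      rewrite mxE; case: unliftP => [j ->|->//].
      by have := xab j; rewrite !mxE.
    exists k => //; rewrite /slice; case: (F k) Fk => [[u v]|//] /= uvx.
    have := uvx ord0; rewrite mxE unlift_none => -> i.
    by have := uvx (lift ord0 i); rewrite !mxE liftK.
pose D := `]a ord0 ord0, b ord0 ord0]%classic.
have mD : measurable (D : set (measurableTypeR R)) by exact: measurable_itv.
have muD : lebesgue_measure D = (b ord0 ord0 - a ord0 ord0)%:E.
  rewrite lebesgue_measure_itv/= lte_fin; case: ltgtP (ab ord0) => //.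
  by move=> ->; rewrite subrr.
have volD : box_vol (Some (a, b)) = (\int[lebesgue_measure]_(t in D)
    box_vol (Some (tail a, tail b)))%E.
  rewrite integral_cst//=. rewrite [X in (_ * X)%E]muD /= big_ord_recl/= -EFinM
    mulrC; congr (_ * _)%:E.
  by apply: eq_bigr => i _; rewrite !mxE.
pose W k (t : R) : \bar R := ((V k)%:E * (\1_(I k) t)%:E)%E.
have mI1 k : measurable_fun (D : set (measurableTypeR R))
    (fun t : R => (\1_(I k) t)%:E : \bar R).
  by apply/measurable_EFinP; exact: measurable_indic.
have mVI k : measurable_fun (D : set (measurableTypeR R)) (W k).
  by apply: measurable_funeM; exact: mI1.
pose S (t : R) : \bar R := (\sum_(k <oo) W k t)%E.
rewrite volD; apply: (@le_trans _ _ (\int[lebesgue_measure]_(t in D) S t)%E).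
  apply: ge0_le_integral => //.
  - by move=> t _; rewrite box_vol_ge0//= => i; rewrite !mxE.
  - apply: (@ge0_emeasurable_sum _ _ _ D _ xpredT) => [k t _ _|k _].
      by rewrite mule_ge0 ?lee_fin.
    exact: mVI.
  - move=> t; rewrite /D/= in_itv/= => /slice_cover;
    under eq_eseriesr do rewrite sliceE.
    by [].
rewrite integral_nneseries//; last by move=> k t _; rewrite mule_ge0 ?lee_fin.
apply: lee_nneseries => k _.
  by move=> _; apply: integral_ge0 => t _; rewrite mule_ge0 ?lee_fin.
rewrite ge0_integralZl ?lee_fin//.
rewrite integral_indic//.
apply: (@le_trans _ _ ((V k)%:E * lebesgue_measure (I k))%E).
  apply: lee_wpmul2l; first by rewrite lee_fin.
  by apply: le_measure; rewrite ?inE//; exact: measurableI (mI k) mD.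
rewrite /V /I; have := F0 k; case: (F k) => [[u v]|] /= uv;
  last by rewrite mul0e.
rewrite lebesgue_measure_itv/= lte_fin big_ord_recl/= mulrC.
rewrite (eq_bigr (fun i => v ord0 (lift ord0 i) - u ord0 (lift ord0 i)));
  last first.
  by move=> i _; rewrite !mxE.
case: ltgtP (uv ord0) => // -> _.
by rewrite subrr mulr0 mule0.
Qed.

Section LebesgueOuter.
Variables (R : realType) (n : nat).

Lemma lebesgue_outer_box (a b : 'rV[R]_n) : (forall i, a ord0 i <= b ord0 i) ->
  lebesgue_outer (box_set (Some (a, b))) = box_vol (Some (a, b)).
Proof.
move=> ab; apply/le_anti/andP; split; last first.
  by apply: le_ereal_inf_tmp => _ [F [PF AF] <-]; exact: box_cover_vol.
apply: ereal_inf_lbound.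
exists (fun k => if k == 0%N then Some (a, b) else None).
  by split=> [k|x abx]; [case: ifP|exists 0%N].
rewrite (nneseries_split 0 1)//; last first.
  by move=> k _; apply: box_vol_ge0; case: ifP.
rewrite big_nat1 [X in (_ + X)%E]eseries0 ?adde0// => k.
by rewrite add0n; case: k.
Qed.

(** The unit ball is squeezed between two boxes. Finiteness matters as much as the lower bound,
    because [fine] sends [+oo] to 0. *)
Lemma hausdorff_const_gt0 : 0 < hausdorff_const R n.
Proof.
rewrite /hausdorff_const divr_gt0 ?exprn_gt0//.
(* A point with coordinates between 0 and [e] has norm at most [n * e <= 1]; the successor covers
   [n = 0]. *)
pose e : R := n.+1%:R^-1.
have e0 : 0 < e by rewrite invr_gt0.
have lo : ((e ^+ n)%:E <=
    lebesgue_outer [set x : 'rV[R]_n | (enorm x <= 1)%R])%E.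
  have := @lebesgue_outer_box 0 (const_mx e) => /=.
  have -> : \prod_(i < n) ((const_mx e : 'rV[R]_n) ord0 i - (0 : 'rV[R]_n) ord0
    i) = e ^+ n.
    rewrite (eq_bigr (fun=> e)); last by move=> i _; rewrite !mxE subr0.
    by rewrite prodr_const card_ord.
  move=> <-; last by move=> i; rewrite !mxE ltW.
  apply: le_cover_outer => x /= xe; apply: (le_trans (enorm_le_sum x)).
  apply: (@le_trans _ _ (\sum_(i < n) e)).
    apply: ler_sum => i _; have := xe i; rewrite !mxE => /andP[? ?].
    by rewrite ger0_norm// ltW.
  rewrite sumr_const card_ord -mulr_natl /e ler_pdivrMr// mul1r ler_nat.
  exact: leqnSn.
have up : (lebesgue_outer [set x : 'rV[R]_n | (enorm x <= 1)%R] <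
    +oo)%E.
  (* The lower corner lies strictly below -1 because half-open boxes omit their lower faces. *)
  have ab i :
      (const_mx (-2) : 'rV[R]_n) ord0 i <= (const_mx 2 : 'rV[R]_n) ord0 i.
    by rewrite !mxE; lra.
  apply: (@le_lt_trans _ _ (lebesgue_outer (box_set (Some (const_mx (-2),
    const_mx 2))))).
    apply: le_cover_outer => x /= x1 i; rewrite !mxE.
    have := le_trans (coord_le_enorm x i) x1; rewrite ler_norml => /andP[? ?].
    by apply/andP; split; lra.
  by rewrite lebesgue_outer_box//= ltey.
apply: fine_gt0; rewrite up andbT (lt_le_trans _ lo)// lte_fin exprn_gt0//.
Qed.

End LebesgueOuter.

(** * Hausdorff measure and Lipschitz maps *)

(** The index [i0] of weight 0 pads the finite family to a sequence. *)
Lemma cover_outer_finite (R : realType) (T I : Type) (P : set I)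
    (cov : I -> set T) (w : I -> \bar R) (J : finType) (F : J -> I) (i0 : I)
    (A : set T) :
  (forall i, P i -> (0 <= w i)%E) -> P i0 -> w i0 = 0%E ->
  (forall j, P (F j)) -> A `<=` \bigcup_j cov (F j) ->
  (cover_outer P cov w A <= \sum_j w (F j))%E.
Proof.
move=> w0 Pi0 wi0 PF AF.
pose G k := if insub k is Some o then F (@enum_val J J o) else i0.
have PG k : P (G k) by rewrite /G; case: insub.
apply: (@le_trans _ _ (\sum_(k <oo) w (G k))%E).
  apply: ereal_inf_lbound; exists G => //; split=> // x /AF[j _ Fjx].
  exists (enum_rank j) => //; rewrite /G insubT// => rj.
  by rewrite (_ : Sub _ _ = enum_rank j) ?enum_rankK//; exact: val_inj.
rewrite (nneseries_split 0 #|J|)//; last by move=> k _; exact: w0.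
rewrite [X in (_ + X)%E]eseries0 ?adde0; last first.
  by move=> k; rewrite add0n => Jk _; rewrite /G insubF// ltnNge Jk.
rewrite add0n big_mkord.
have -> : (\sum_j w (F j) = \sum_(j in J) w (F j))%E by exact: eq_bigl.
rewrite (big_enum_val (fun j => w (F j))).
by apply: lee_sum => k _; rewrite /G valK.
Qed.

Section HausdorffBounds.
Variables (R : realType) (n d : nat).
Implicit Types A B : set 'rV[R]_n.
Let c := hausdorff_const R d.

Lemma hausdorff_weight_le A (D : R) : 0 <= D ->
  (forall x y, A x -> A y -> enorm (x - y) <= D) ->
  (hausdorff_weight d A <= (c * D ^+ d)%:E)%E.
Proof.
move=> D0 AD; have c0 := hausdorff_const_gt0 R d; rewrite /hausdorff_weight.
case: ifPn => [_|/set0P[x Ax]].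
  by rewrite lee_fin mulr_ge0 ?exprn_ge0// ltW.
have dA : (diam A <= D%:E)%E.
  by apply: ge_ereal_sup => _ [[u v] [/= Au Av] <-]; rewrite lee_fin AD.
have d0 : (0 <= diam A)%E.
  by apply: le_trans (le_diam Ax Ax); rewrite lee_fin enorm_ge0.
have dfin : diam A \is a fin_num.
  by rewrite ge0_fin_numE// (le_lt_trans dA)// ltey.
move: d0 dA; rewrite -(fineK dfin) !lee_fin -EFin_expe -EFinM lee_fin => d0 dA.
by rewrite ler_pM2l// lerXn2r.
Qed.

(** If [F k] covers part of [A] and has diameter [D], its image under [f] lies in a cube of side
    slightly more than [2 * D]. These cubes cover the box, so their volumes add up to at least its
    own; the doubled side explains the factor [2 ^ d]. *)
Lemma hausdorff_outer_ge A (f : 'rV[R]_n -> 'rV[R]_d) (a b : 'rV[R]_d) :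
  (forall i, a ord0 i <= b ord0 i) ->
  (forall x y i, A x -> A y -> `|f x ord0 i - f y ord0 i| <= enorm (x - y)) ->
  box_set (Some (a, b)) `<=` f @` A ->
  ((c * \prod_i (b ord0 i - a ord0 i))%:E <=
   (2 ^+ d)%:E * hausdorff_outer d A)%E.
Proof.
move=> ab fA abA; have c0 := hausdorff_const_gt0 R d.
(* The scale 1 is arbitrary: it only makes the diameters of the covering sets finite. *)
apply: (@le_trans _ _ ((2 ^+ d)%:E * hausdorff_delta d 1 A)%E); last first.
  apply: lee_wpmul2l; first by rewrite lee_fin exprn_ge0.
  by apply: ereal_sup_ubound; exists 1 => /=.
rewrite muleC -lee_pdivrMr ?exprn_gt0//.
apply: le_ereal_inf_tmp => _ [F [Fdiam AF] <-].
rewrite lee_pdivrMr ?exprn_gt0// muleC.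
have w0 k : (0 <= hausdorff_weight d (F k))%E by exact: hausdorff_weight_ge0.
rewrite -nneseriesZl ?lee_fin ?exprn_ge0//.
apply/lee_addgt0Pr => e e0.
pose Q k (o : option ('rV[R]_d * 'rV[R]_d)) :=
  [/\ nonneg_box o, f @` (A `&` F k) `<=` box_set o &
   (c%:E * box_vol o <= (2 ^+ d)%:E * hausdorff_weight d (F k) +
     (e / (2 ^ k.+1)%:R)%:E)%E].
have [B QB] : {B : nat -> option ('rV[R]_d * 'rV[R]_d) & forall k, Q k (B k)}.
  apply: (@choice _ _ Q) => k.
  have ek : 0 < e / (2 ^ k.+1)%:R by rewrite divr_gt0// ltr0n expn_gt0.
  have [AF0|/set0P[x [Ax Fx]]] := eqVneq (A `&` F k) set0.
    exists None; split=> //=; first by rewrite AF0 image_set0.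
    by rewrite mule0 adde_ge0 ?mule_ge0 ?lee_fin ?exprn_ge0// ltW.
  have d0 : (0 <= diam (F k))%E.
    by apply: le_trans (le_diam Fx Fx); rewrite lee_fin enorm_ge0.
  have dfin : diam (F k) \is a fin_num.
    by rewrite ge0_fin_numE// (le_lt_trans (Fdiam k))// ltey.
  pose D := fine (diam (F k)).
  have D0 : 0 <= D by exact: fine_ge0.
  (* The margin [h] puts the image inside a half-open box even when [D = 0]. By continuity it can be
     small enough for its cost to fit in the [k]-th share of [e]. *)
  have [h h0 hD] : exists2 h, 0 < h &
      c * (2 * (D + h)) ^+ d < 2 ^+ d * (c * D ^+ d) + e / (2 ^ k.+1)%:R.
    have cvg : c * (2 * (D + h)) ^+ d @[h --> 0^'+] --> c * (2 * (D + 0)) ^+ d.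
      apply: cvg_at_right_filter; apply: cvgM; first exact: cvg_cst.
      apply: (@cvg_comp _ _ _ (fun h => 2 * (D + h)) (fun t => t ^+ d));
        last first.
        exact: exprn_continuous.
      by apply: cvgM; [exact: cvg_cst|apply: cvgD;
        [exact: cvg_cst|exact: cvg_id]].
    have lt0 : c * (2 * (D + 0)) ^+ d < 2 ^+ d * (c * D ^+ d) + e / (2 ^
      k.+1)%:R.
      by rewrite addr0 exprMn mulrCA ltrDl.
    have near1 : \forall h \near 0^'+,
        c * (2 * (D + h)) ^+ d < 2 ^+ d * (c * D ^+ d) + e / (2 ^ k.+1)%:R.
      exact: cvgr_lt cvg _ lt0.
    have [h [h0 hD]] := filter_ex (filterI (@nbhs_right_gt R 0) near1).
    by exists h.
  exists (Some (f x - const_mx (D + h), f x + const_mx (D + h))).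
  have Dh : 0 <= D + h by rewrite addr_ge0// ltW.
  split.
  - by move=> i; rewrite !mxE; lra.
  - move=> _ [y [Ay Fy] <-] i; rewrite !mxE.
    have := le_diam Fy Fx; rewrite -(fineK dfin) lee_fin -/D => yxD.
    have := le_trans (fA y x i Ay Ax) yxD; rewrite ler_norml => /andP[? ?].
    by apply/andP; split; lra.
  - rewrite /hausdorff_weight ifF; last by apply/negbTE/set0P; exists x.
    rewrite /= -(fineK dfin) -/D -EFin_expe -!EFinM -EFinD lee_fin.
    rewrite (eq_bigr (fun=> 2 * (D + h))); last first.
      by move=> i _; rewrite !mxE; lra.
    by rewrite prodr_const card_ord; exact: ltW.
have : (box_vol (Some (a, b)) <= \sum_(k <oo) box_vol (B k))%E.
  apply: box_cover_vol => // [k|y aby]; first by have [] := QB k.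
  have [x Ax <-] := abA y aby; have [k _ Fkx] := AF x Ax.
  by exists k => //; have [_ + _] := QB k; apply; exists x.
move=> /(@lee_wpmul2l _ c%:E); rewrite lee_fin => /(_ (ltW c0)).
rewrite -EFinM => /le_trans; apply.
rewrite -nneseriesZl; last by move=> k _; apply: box_vol_ge0; have [] := QB k.
apply: le_trans (epsilon_trick _ _ (ltW e0)); last first.
  by move=> k; rewrite mule_ge0 ?lee_fin ?exprn_ge0.
apply: lee_nneseries => [k _ _|k _]; last by have [] := QB k.
by rewrite mule_ge0 ?lee_fin ?(ltW c0)// box_vol_ge0//; have [] := QB k.
Qed.

(** Cutting the cube into [N ^ d] cells of side [2 * t / N] gives images of diameter at most
    [2 * L * t / N]. Their total weight is [c * (2 * L * t) ^ d] whatever [N] is, so the bound holds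
    at every scale [delta]. *)
Lemma hausdorff_outer_le A (f : 'rV[R]_d -> 'rV[R]_n) (y0 : 'rV[R]_d)
    (L t : R) : 0 <= L -> 0 <= t ->
  (forall y y', `|y - y0| <= t -> `|y' - y0| <= t ->
    enorm (f y - f y') <= L * `|y - y'|) ->
  A `<=` f @` [set y | `|y - y0| <= t] ->
  (hausdorff_outer d A <= (c * (2 * L * t) ^+ d)%:E)%E.
Proof.
move=> L0 t0 fL Af; have c0 := hausdorff_const_gt0 R d.
apply: ge_ereal_sup => _ [delta /= delta0 <-].
pose N := (Num.truncn (2 * L * t / delta)).+1.
have N0 : (0 < N%:R :> R) by rewrite ltr0n.
have Ndelta : 2 * L * t / N%:R <= delta.
  by rewrite ler_pdivrMr// [leRHS]mulrC -ler_pdivrMr//; exact/ltW/truncnS_gt.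
pose h := 2 * t / N%:R.
have h0 : 0 <= h by rewrite divr_ge0// ?mulr_ge0// ltW.
pose cell (phi : {ffun 'I_d -> 'I_N}) : set 'rV[R]_d :=
  [set y | `|y - y0| <= t /\ forall i,
    y0 ord0 i - t + h * (phi i)%:R <= y ord0 i <=
    y0 ord0 i - t + h * (phi i).+1%:R].
pose F phi := f @` cell phi.
have Fdiam phi x x' : F phi x -> F phi x' -> enorm (x - x') <= L * h.
  move=> [y [yt yphi] <-] [y' [yt' yphi'] <-].
  apply: (le_trans (fL _ _ yt yt')); apply: ler_wpM2l => //.
  have -> : `|y - y'| = mx_norm (y - y') by [].
  rewrite mx_normrE; apply/bigmax_leP; split=> [//|[i j] _ /=].
  rewrite ord1 !mxE ler_norml.
  have := yphi j; have := yphi' j; rewrite -!natr1 mulrDr mulr1.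
  by move=> /andP[? ?] /andP[? ?]; apply/andP; split; lra.
have diam_le (B : set 'rV[R]_n) (D : R) :
    (forall x y, B x -> B y -> enorm (x - y) <= D) -> (diam B <= D%:E)%E.
  by move=> BD; apply: ge_ereal_sup => _ [[u v] [/= Bu Bv] <-];
    rewrite lee_fin BD.
have Lh : 0 <= L * h by rewrite mulr_ge0.
have Lhd : L * h <= delta by rewrite /h mulrA (mulrCA L 2) mulrA.
apply: (le_trans (@cover_outer_finite _ _ _ _ _ _ _ F set0 A _ _ _ _ _)).
- by move=> B _; exact: hausdorff_weight_ge0.
- by apply: diam_le.
- by rewrite /hausdorff_weight eqxx.
- by move=> phi /=; apply: diam_le => x y Fx Fy; apply: le_trans Lhd;
  exact: Fdiam Fx Fy.
- move=> x /Af[y yt <-].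
  have /choice[phi phiP] : forall i, exists j : 'I_N,
      y0 ord0 i - t + h * j%:R <= y ord0 i <= y0 ord0 i - t + h * j.+1%:R.
    move=> i; have := le_trans (norm_coord_le (y - y0) i) yt.
    rewrite !mxE ler_norml => /andP[y1 y2].
    (* When [t = 0] the cells have side 0 and dividing by [h] locates nothing; any cell will do. *)
    have [t00|tn0] := eqVneq t 0.
      have h00 : h = 0 by rewrite /h t00 mulr0 mul0r.
      by exists ord0; rewrite h00 !mul0r; move: y1 y2 t00; lra.
    have hgt0 : 0 < h by rewrite divr_gt0// mulr_gt0// lt0r tn0.
    pose u := (y ord0 i - (y0 ord0 i - t)) / h.
    have u0 : 0 <= u by rewrite divr_ge0//; lra.
    have uN : u <= N%:R.
      rewrite ler_pdivrMr// /h mulrCA divff ?gt_eqF// mulr1; lra.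
    have yE : y ord0 i = y0 ord0 i - t + h * u.
      by rewrite /u mulrCA divff ?gt_eqF// mulr1; lra.
    have [uN1|uN1] := ltP u N%:R.
      have jN : (Num.truncn u < N)%N by rewrite truncn_lt_nat.
      exists (Ordinal jN); rewrite yE !lerD2l !ler_pM2l//=.
        apply/andP; split; first by rewrite truncn_le.
        exact/ltW/truncnS_gt.
    (* The right end of the side, [u = N], belongs to the last cell. *)
    exists ord_max; rewrite yE !lerD2l !ler_pM2l//=; apply/andP; split=> //.
    by apply: le_trans uN1; rewrite ler_nat.
  exists [ffun i => phi i] => //; exists y => //; split=> // i.
  by rewrite ffunE.
apply: (@le_trans _ _
    (\sum_(phi : {ffun 'I_d -> 'I_N}) (c * (L * h) ^+ d)%:E)%E).
  by apply: lee_sum => phi _; apply: hausdorff_weight_le => //; exact: Fdiam.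
rewrite sumEFin lee_fin sumr_const card_ffun !card_ord -[leLHS]mulr_natl natrX.
rewrite mulrCA -exprMn /h; rewrite le_eqVlt; apply/orP; left; apply/eqP;
  congr (_ * _ ^+ _).
by rewrite mulrC; field; rewrite gt_eqF.
Qed.

End HausdorffBounds.

(** * Graph charts of the boundary *)

Lemma is_derive_line (R : realType) (m : nat) (g : 'rV[R]_m -> R)
    (y v : 'rV[R]_m) (t : R) : differentiable g (y + t *: v) ->
  is_derive t 1 (fun u : R => g (y + u *: v)) ('d g (y + t *: v) v).
Proof.
move=> dg.
have E : (fun h : R => h^-1 *:
      (((fun u : R => g (y + u *: v)) \o shift t) (h *: 1) - g (y + t *: v))) =
    (fun h : R => h^-1 *:
      ((g \o shift (y + t *: v)) (h *: v) - g (y + t *: v))).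
  apply/funext => h; congr (_ *: (g _ - _)).
  by rewrite /= [h *: 1]mulr1 scalerDl addrCA.
split.
  by rewrite /derivable E; exact: diff_derivable.
by rewrite /derive E -deriveE.
Qed.

(** The differential is Lipschitz, hence bounded on a ball, and the ball is convex, so the mean
    value theorem applies along the segment from [y] to [y']. *)
Lemma C11_locally_lipschitz (R : realType) (m : nat) (g : 'rV[R]_m -> R)
    (K : R) :
  C11 g -> exists2 L : R, 0 <= L & forall y y' : 'rV[R]_m,
    `|y| <= K -> `|y'| <= K -> `|g y - g y'| <= L * `|y - y'|.
Proof.
move=> [dg [L0 gL]].
pose S := \sum_i `|'d g (0 : 'rV[R]_m) (delta_mx ord0 i)|.
have dg0 v : `|'d g (0 : 'rV[R]_m) v| <= S * `|v|.
  rewrite {1}(row_sum_delta v) linear_sum mulr_suml.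
  apply: (le_trans (ler_norm_sum _ _ _)); apply: ler_sum => i _.
  rewrite linearZ_LR normrZ mulrC; apply: ler_wpM2l => //; exact: norm_coord_le.
(* [S] bounds the differential at 0 and the second term its variation up to norm [K]; each factor
   [m] compares the Euclidean norm with the sup norm. The absolute values allow for negative [L0] or
   [K]. *)
exists (S + `|L0| * (m%:R * `|K|) * m%:R).
  by rewrite addr_ge0 ?sumr_ge0// !mulr_ge0.
move=> y y' yK y'K; pose v := y' - y.
have cont : {within `[0, 1], continuous (fun t : R => g (y + t *: v))}.
  apply: continuous_subspaceT => t.
  have [/derivable1_diffP/differentiable_continuous + _] := is_derive_line (dg
    (y + t *: v)).
  exact.
have [t _|c] := @MVT_segment R (fun t => g (y + t *: v))
  (fun t => 'd g (y + t *: v) v) 0 1 ler01 _ cont.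
  exact: is_derive_line.
rewrite in_itv/= => /andP[c0 c1].
have yv : y + v = y' by rewrite /v addrC subrK.
rewrite scale1r scale0r addr0 subr0 mulr1 yv => gE.
rewrite distrC gE -[y - y']opprB normrN -/v.
set u := y + c *: v.
have uK : `|u| <= `|K|.
  have -> : u = (1 - c) *: y + c *: y'.
    by rewrite /u /v scalerBr scalerBl scale1r addrA addrAC.
  apply: (le_trans (ler_normD _ _)); rewrite !normrZ (ger0_norm c0).
  rewrite (ger0_norm (_ : 0 <= 1 - c)) ?subr_ge0//.
  rewrite (le_trans _ (ler_norm K))//.
  have := ler_wpM2l c0 y'K.
  have c1' : 0 <= 1 - c by rewrite subr_ge0.
  by have := ler_wpM2l c1' yK; lra.
have gu : `|'d g u v - 'd g (0 : 'rV[R]_m) v| <=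
    `|L0| * (m%:R * `|K|) * m%:R * `|v|.
  apply: (le_trans (gL _ _ _)); rewrite subr0 -[leRHS]mulrA.
  apply: (@le_trans _ _ (`|L0| * enorm u * enorm v)).
    by rewrite !ler_wpM2r ?enorm_ge0// ler_norm.
  rewrite ler_pM ?mulr_ge0 ?enorm_ge0 ?enorm_le_norm// ler_wpM2l//.
  by rewrite (le_trans (enorm_le_norm u))// ler_wpM2l.
rewrite -['d g u v](subrK ('d g (0 : 'rV[R]_m) v)) mulrDl.
by rewrite (le_trans (ler_normD _ _))// addrC lerD.
Qed.

Section Chart.
Variables (R : realType) (n : nat) (i : 'I_n) (g : 'rV[R]_n.-1 -> R).

Definition graph_point (y : 'rV[R]_n.-1) : 'rV[R]_n :=
  \row_j (if unlift i j is Some k then y ord0 k else g y).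

Lemma col'_graph_point y : col' i (graph_point y) = y.
Proof. by apply/rowP => k; rewrite !mxE liftK. Qed.

Lemma graph_point_coord y : graph_point y ord0 i = g y.
Proof. by rewrite mxE unlift_none. Qed.

Lemma graph_pointE (x : 'rV[R]_n) : g (col' i x) = x ord0 i ->
  graph_point (col' i x) = x.
Proof.
move=> gx; apply/rowP => j; rewrite mxE.
by case: unliftP => [k ->|->]; rewrite ?mxE.
Qed.

Lemma graph_point_lipschitz (L : R) y y' : 0 <= L ->
  `|g y - g y'| <= L * `|y - y'| ->
  enorm (graph_point y - graph_point y') <= n%:R * (1 + L) * `|y - y'|.
Proof.
move=> L0 gL; apply: (le_trans (enorm_le_norm _)); rewrite -mulrA ler_wpM2l//.
have -> : `|graph_point y - graph_point y'| =
    mx_norm (graph_point y - graph_point y') by [].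
rewrite mx_normrE; apply/bigmax_leP; split=> [|[k j] _ /=].
  by rewrite mulr_ge0// addr_ge0.
rewrite ord1 !mxE mulrDl mul1r; case: unliftP => [l _|_].
  by have := norm_coord_le (y - y') l; rewrite !mxE => /le_trans; apply;
    rewrite lerDl mulr_ge0.
by rewrite (le_trans gL)// lerDr.
Qed.

End Chart.

Lemma enorm_orthogonal (R : realType) (n : nat) (Q : 'M[R]_n) (x : 'rV[R]_n) :
  Q *m Q^T = 1%:M -> enorm (x *m Q) = enorm x.
Proof.
have E (y : 'rV[R]_n) : \sum_j y ord0 j ^+ 2 = (y *m y^T) ord0 ord0.
  by rewrite mxE; apply: eq_bigr => j _; rewrite mxE.
by move=> QQ; rewrite /enorm !E trmx_mul mulmxA -(mulmxA x) QQ mulmx1.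
Qed.

Lemma enorm_orthogonalT (R : realType) (n : nat) (Q : 'M[R]_n) (x : 'rV[R]_n) :
  Q *m Q^T = 1%:M -> enorm (x *m Q^T) = enorm x.
Proof. by move=> QQ; rewrite enorm_orthogonal// trmxK; exact: mulmx1C. Qed.

Section EuclideanTopology.
Variables (R : realType) (n : nat).
Implicit Types (x w : 'rV[R]_n) (A B : set 'rV[R]_n).

Lemma nbhs_enormP w B :
  nbhs w B <-> exists2 e : R, 0 < e & forall x, enorm (x - w) < e -> B x.
Proof.
split=> [/nbhs_normP[e /= e0 eB]|[e e0 eB]].
  exists e => // x xw; apply: eB; rewrite /ball_/= distrC.
  exact: le_lt_trans (norm_le_enorm _) xw.
(* The successor keeps the radius positive when [n = 0]. *)
apply/(@nbhs_normP R _ w B); exists (e / n.+1%:R) => /=;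
  first by rewrite divr_gt0.
move=> x /=; rewrite /ball_/= distrC => xw; apply: eB.
apply: (le_lt_trans (enorm_le_norm _)).
apply: (@le_lt_trans _ _ (n.+1%:R * `|x - w|)).
  by rewrite ler_wpM2r// ler_nat.
by rewrite mulrC -ltr_pdivlMr.
Qed.

Lemma closure_enormP A w :
  closure A w <-> forall e : R, 0 < e -> exists2 x, A x & enorm (x - w) < e.
Proof.
split=> [Aw e e0|Aw B /nbhs_enormP[e e0 eB]].
  have [|x [Ax xw]] := Aw [set x | enorm (x - w) < e]; last by exists x.
  by apply/nbhs_enormP; exists e.
by have [x Ax xw] := Aw e e0; exists x; split=> //; exact: eB.
Qed.

Lemma closed_boundary A : closed (boundary A).
Proof.
by apply: closedI; [exact: closed_closure|exact/open_closedC/open_interior].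
Qed.

Lemma boundary_notin A w : open A -> boundary A w -> ~ A w.
Proof. by move=> oA [_ +]; rewrite ((interior_id A).1 oA). Qed.

End EuclideanTopology.

Section LocalRegularity.
Variables (R : realType) (n : nat) (Omega : set 'rV[R]_n) (z : 'rV[R]_n).
Variables (r : R) (Q : 'M[R]_n) (i : 'I_n) (g : 'rV[R]_n.-1 -> R).
Hypotheses (oOmega : open Omega) (r0 : 0 < r) (QQ : Q *m Q^T = 1%:M).
Hypothesis C11g : C11 g.
Hypothesis chart : forall x, enorm (x - z) < r ->
  (Omega x <-> g (col' i (x *m Q)) < (x *m Q) ord0 i).

Lemma col'_chart_dist (x w : 'rV[R]_n) :
  `|col' i (x *m Q) - col' i (w *m Q)| <= enorm (x - w).
Proof.
rewrite -(enorm_orthogonal (x - w) QQ) mulmxBl -[leLHS]/(mx_norm _).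
rewrite mx_normrE; apply/bigmax_leP; split=> [|[k j] _ /=];
  first exact: enorm_ge0.
rewrite ord1; have := coord_le_enorm (x *m Q - w *m Q) (lift i j).
by rewrite !mxE.
Qed.

(** A point strictly below the graph has a neighbourhood below it, since [g] is locally Lipschitz,
    so it is not in the closure. A point on the graph is a limit of points of [Omega] lying
    vertically above it. *)
Lemma boundary_chart (w : 'rV[R]_n) : enorm (w - z) < r ->
  boundary Omega w <-> g (col' i (w *m Q)) = (w *m Q) ord0 i.
Proof.
move=> wz; split=> [bw|gw].
  have := boundary_notin oOmega bw; rewrite chart// => /negP;
    rewrite -leNgt => gw.
  apply/le_anti; rewrite gw andbT leNgt; apply/negP => {}gw.
  pose K := `|col' i (w *m Q)| + r.
  have [L L0 gL] := C11_locally_lipschitz K C11g.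
  pose h := g (col' i (w *m Q)) - (w *m Q) ord0 i.
  have h0 : 0 < h by rewrite subr_gt0.
  (* The three bounds keep [x] in the chart, keep its horizontal coordinates within norm [K], and
     make [(L + 1) * enorm (x - w)], the largest possible change of height relative to the graph,
     less than the gap [h]. *)
  pose e := Num.min (r - enorm (w - z)) (Num.min r (h / (L + 1))).
  have L1 : 0 < L + 1 by rewrite ltr_wpDl.
  have e0 : 0 < e by rewrite !lt_min subr_gt0 wz r0 divr_gt0.
  have [/closure_enormP cw _] := bw; have [x Ox] := cw e e0.
  rewrite !lt_min => /and3P[xw1 xw2 xw3].
  have xz : enorm (x - z) < r.
    by apply: (le_lt_trans (enormB _ w _)); lra.
  have gx := (chart xz).1 Ox.
  have xi : `|(x *m Q) ord0 i - (w *m Q) ord0 i| <= enorm (x - w).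
    have := coord_le_enorm (x *m Q - w *m Q) i.
    by rewrite -mulmxBl (enorm_orthogonal _ QQ) mulmxBl !mxE.
  have dxw := col'_chart_dist x w.
  have wK : `|col' i (w *m Q)| <= K by rewrite lerDl ltW.
  have xK : `|col' i (x *m Q)| <= K.
    rewrite -(subrK (col' i (w *m Q)) (col' i (x *m Q))).
    apply: (le_trans (ler_normD _ _)); rewrite addrC lerD2l.
    by apply: (le_trans dxw); exact: ltW.
  have := gL _ _ xK wK; have := ler_wpM2l L0 dxw.
  have : enorm (x - w) * (L + 1) < h by rewrite -ltr_pdivlMr.
  move: xi; rewrite /h !ler_norml => /andP[? ?] ? ? /andP[? ?].
  by nra.
split; last first.
  by rewrite ((interior_id Omega).1 oOmega) /= chart// gw ltxx.
apply/closure_enormP => e e0.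
pose e' := Num.min e (r - enorm (w - z)) / 2.
have me : 0 < Num.min e (r - enorm (w - z)) by rewrite lt_min e0 subr_gt0.
have e'0 : 0 < e' by rewrite divr_gt0.
have e'e : e' < e by apply: (@lt_le_trans _ _ (Num.min e (r - enorm (w - z))));
  [rewrite /e'; lra|rewrite ge_min lexx].
have e'r : e' < r - enorm (w - z).
  by apply: (@lt_le_trans _ _ (Num.min e (r - enorm (w - z)))); [rewrite /e';
    lra|rewrite ge_min lexx orbT].
pose ei : 'rV[R]_n := \row_j (e' * (j == i)%:R).
have ei_norm : enorm ei = e'.
  rewrite /enorm (bigD1 i)//= big1 ?addr0; last first.
    by move=> j /negPf ji; rewrite mxE ji mulr0 expr0n.
  by rewrite mxE eqxx mulr1 sqrtr_sqr gtr0_norm.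
(* In the coordinates [x *m Q] this raises [w] by [e'] along the [i]-th axis. *)
pose x := w + ei *m Q^T.
have xw : enorm (x - w) = e'.
  by rewrite /x addrC addKr (enorm_orthogonalT _ QQ).
exists x; last by rewrite xw.
apply/chart.
  by apply: (le_lt_trans (enormB _ w _)); rewrite xw; lra.
have QtQ : Q^T *m Q = 1%:M by exact: mulmx1C.
have -> : x *m Q = w *m Q + ei.
  by rewrite /x mulmxDl -mulmxA QtQ mulmx1.
have -> : col' i (w *m Q + ei) = col' i (w *m Q).
  by apply/rowP => k; rewrite !mxE [lift i k == i]eq_sym (negPf (neq_lift i k))
    mulr0 addr0.
by rewrite gw !mxE eqxx mulr1 ltrDl.
Qed.

Local Notation H A := (hausdorff_outer n.-1 A).

(** The lift [f] of the horizontal coordinates to the graph is [C]-Lipschitz and its inverse, the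
    projection, does not increase distances. The first fact bounds the measure of a ball from above,
    the second from below. *)
Lemma chart_ahlfors : exists2 k : R, 0 < k & forall w (t : R),
  boundary Omega w -> enorm (w - z) < k -> 0 < t <= k ->
  ((k * t ^+ n.-1)%:E <=
    H (boundary Omega `&` [set y | (enorm (y - w) < t)%R]))%E /\
  (H (boundary Omega `&` [set y | (enorm (y - w) < t)%R]) <=
    (k^-1 * t ^+ n.-1)%:E)%E.
Proof.
set d := n.-1.
pose K := `|col' i (z *m Q)| + r.
have [L L0 gL] := C11_locally_lipschitz K C11g.
pose C := n%:R * (1 + L).
have n0 : (1 : R) <= n%:R by rewrite ler1n;
  exact: leq_ltn_trans (leq0n i) (ltn_ord i).
have C1 : 1 <= C by rewrite /C; nra.
have C0 : 0 < C by lra.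
pose G := @graph_point R n i g.
pose c := hausdorff_const R d.
have c0 : 0 < c by exact: hausdorff_const_gt0.
pose f y := G y *m Q^T.
have fC y y' : `|y| <= K -> `|y'| <= K -> enorm (f y - f y') <= C * `|y - y'|.
  move=> yK y'K; rewrite -mulmxBl (enorm_orthogonalT _ QQ).
  exact: (graph_point_lipschitz i L0 (gL _ _ yK y'K)).
pose A w t := boundary Omega `&` [set y | enorm (y - w) < t].
have QtQ : Q^T *m Q = 1%:M by exact: mulmx1C.
have upper w t : boundary Omega w -> enorm (w - z) < r / 2 -> 0 < t <= r / 2 ->
    (H (A w t) <= (c * (2 * C) ^+ d * t ^+ d)%:E)%E.
  move=> bw wz /andP[t0 tr]; rewrite -mulrA -exprMn.
  pose y0 := col' i (w *m Q).
  have y0z := col'_chart_dist w z.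
  have cubeK y : `|y - y0| <= t -> `|y| <= K.
    have := ler_normD (y - y0) y0;
      have := ler_normD (y0 - col' i (z *m Q)) (col' i (z *m Q)).
    by rewrite !subrK /K; lra.
  apply: (@hausdorff_outer_le _ _ _ _ f y0 C t _ (ltW t0)); first exact: ltW.
    by move=> y y' yt y't; apply: fC; exact: cubeK.
  move=> x [bx /= xw].
  have xz : enorm (x - z) < r by apply: (le_lt_trans (enormB _ w _)); lra.
  have gx := (boundary_chart xz).1 bx.
  exists (col' i (x *m Q)) => /=.
    by apply: (le_trans (col'_chart_dist x w)); exact: ltW.
  by rewrite /f /G graph_pointE// -mulmxA QQ mulmx1.
have lower w t : boundary Omega w -> enorm (w - z) < r / 2 -> 0 < t <= r / 2 ->
    ((c * ((2 * C)^-1) ^+ d * t ^+ d)%:E <= H (A w t))%E.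
  move=> bw wz /andP[t0 tr].
  pose y0 := col' i (w *m Q).
  have y0z := col'_chart_dist w z.
  (* On the cube of half-side [h] the lift stays within [t / 2] of [w], so the projection of the
     ball contains this cube. As [C >= 1], the cube remains where the Lipschitz bound holds. *)
  pose h := t / (2 * C).
  have h0 : 0 < h by rewrite divr_gt0// mulr_gt0.
  have Ch : C * h = t / 2 by rewrite /h; field; rewrite gt_eqF.
  have ht : h <= t / 2 by rewrite -Ch ler_peMl// ltW.
  have wz' : enorm (w - z) < r by lra.
  have fw : f y0 = w.
    by rewrite /f /G graph_pointE ?(boundary_chart wz').1// -mulmxA QQ mulmx1.
  have y0K : `|y0| <= K.
    have := ler_normD (y0 - col' i (z *m Q)) (col' i (z *m Q)).
    by rewrite subrK /K; lra.
  have Hge : ((c * \prod_j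
      ((y0 + const_mx h) ord0 j - (y0 - const_mx h) ord0 j))%:E <=
      (2 ^+ d)%:E * H (A w t))%E.
    apply: (@hausdorff_outer_ge _ _ _ _ (fun x => col' i (x *m Q))).
    - by move=> j; rewrite !mxE; lra.
    - move=> x x' j _ _; apply: le_trans (col'_chart_dist x x').
      by have := norm_coord_le (col' i (x *m Q) - col' i (x' *m Q)) j;
        rewrite !mxE.
    - move=> y yb; exists (f y); last first.
        by rewrite /f -mulmxA QtQ mulmx1 col'_graph_point.
      have yy0 : `|y - y0| <= h.
        rewrite -[leLHS]/(mx_norm _) mx_normrE; apply/bigmax_leP;
          split=> [|[l j] _ /=].
          exact: ltW.
        rewrite ord1; have := yb j; rewrite !mxE ler_norml => /andP[? ?].
        by apply/andP; split; lra.
      have yK : `|y| <= K.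
        have := ler_normD (y - y0) y0.
        have := ler_normD (y0 - col' i (z *m Q)) (col' i (z *m Q)).
        by rewrite !subrK /K; lra.
      have fyw : enorm (f y - w) < t.
        rewrite -fw; apply: (le_lt_trans (fC _ _ yK y0K)).
        by have := ler_wpM2l (ltW C0) yy0; rewrite Ch; lra.
      split=> //; apply/boundary_chart.
        by apply: (le_lt_trans (enormB _ w _)); lra.
      by rewrite /f -mulmxA QtQ mulmx1 col'_graph_point graph_point_coord.
  rewrite muleC -lee_pdivrMr ?exprn_gt0// in Hge.
  apply: le_trans Hge; rewrite -EFinM lee_fin.
  rewrite (eq_bigr (fun=> 2 * h)); last by move=> j _; rewrite !mxE; lra.
  have hE : 2 * h = 2 * ((2 * C)^-1 * t) by rewrite /h [(2 * C)^-1 * t]mulrC.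
  rewrite prodr_const card_ord hE !exprMn [leRHS](_ : _ =
    c * ((2 * C)^-1 ^+ d * t ^+ d) * (2 ^+ d * (2 ^+ d)^-1)).
    by rewrite divff ?mulr1 ?mulrA// gt_eqF// exprn_gt0.
  by ring.
pose k1 := c * ((2 * C)^-1) ^+ d; pose k2 := c * (2 * C) ^+ d.
have k10 : 0 < k1 by rewrite mulr_gt0// exprn_gt0// invr_gt0 mulr_gt0.
have k20 : 0 < k2 by rewrite mulr_gt0// exprn_gt0// mulr_gt0.
(* One number serves as admissible radius, lower constant and inverse of the upper constant. *)
exists (Num.min (r / 2) (Num.min k1 k2^-1)).
  by rewrite !lt_min divr_gt0// k10 invr_gt0 k20.
set k := Num.min _ _; have k0 : 0 < k.
  by rewrite !lt_min divr_gt0// k10 invr_gt0 k20.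
have kr : k <= r / 2 by rewrite ge_min lexx.
move=> w t bw wz /andP[t0 tk].
have wz' : enorm (w - z) < r / 2 by lra.
have t' : 0 < t <= r / 2 by rewrite t0; lra.
split.
  apply: le_trans (lower w t bw wz' t'); rewrite lee_fin ler_pM2r ?exprn_gt0//.
  by rewrite !ge_min lexx orbT.
apply: (le_trans (upper w t bw wz' t')); rewrite lee_fin ler_pM2r ?exprn_gt0//.
by rewrite -[leLHS]invrK lef_pV2 ?posrE ?invr_gt0// !ge_min lexx !orbT.
Qed.

End LocalRegularity.

(** * Ahlfors regularity of the boundary *)

Section Domain.
Variables (R : realType) (n : nat) (Omega : set 'rV[R]_n).
Hypotheses (n1 : (1 <= n)%N) (dOmega : bounded_domain Omega).

Lemma domain_open : open Omega.
Proof. by case: dOmega. Qed.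

Lemma domain_diam : exists2 M : R, 0 < M &
  forall x z, Omega x -> boundary Omega z -> enorm (x - z) < M.
Proof.
have [B OB] : exists B : R, forall x, Omega x -> `|x| <= B.
  have [_ _ _ [B [_ OB]]] := dOmega.
  by exists (B + 1) => x Ox; apply: OB => //; rewrite ltrDl.
pose B1 := `|B|.
have OB1 x : Omega x -> `|x| <= B1 by move=> /OB/le_trans; apply;
  exact: ler_norm.
exists (n%:R * (B1 + (B1 + 1)) + 1).
  by rewrite ltr_wpDl// mulr_ge0// !addr_ge0// normr_ge0.
move=> x z Ox [/closure_enormP cz _].
have [y Oy yz] := cz 1 ltr01.
have zB : `|z| <= B1 + 1.
  have -> : z = y - (y - z) by rewrite opprB addrC subrK.
  rewrite (le_trans (ler_normB _ _))// lerD ?OB1//.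
  by rewrite (le_trans (norm_le_enorm _))// ltW.
apply: (le_lt_trans (enorm_le_norm _)).
apply: (@le_lt_trans _ _ (n%:R * (B1 + (B1 + 1)))); last by rewrite ltrDl.
by rewrite ler_wpM2l// (le_trans (ler_normB _ _))// lerD ?OB1.
Qed.

Lemma compact_boundary : compact (boundary Omega).
Proof.
have [[x0 Ox0] _ _ _] := dOmega; have [M M0 OM] := domain_diam.
apply: bounded_closed_compact; last exact: closed_boundary.
exists (`|x0| + M); split; first exact: num_real.
move=> K MK z bz; apply: le_trans (ltW MK).
have -> : z = x0 - (x0 - z) by rewrite opprB addrC subrK.
rewrite (le_trans (ler_normB _ _))// lerD2l (le_trans (norm_le_enorm _))//.
exact/ltW/OM.
Qed.

(** With empty boundary [Omega] would be open and closed. The line through [x0] in the direction of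
    the all-ones vector would then stay inside it, as the real line is connected, contradicting
    boundedness. *)
Lemma boundary_neq0 : boundary Omega !=set0.
Proof.
have [[x0 Ox0] oO _ [B' [_ OB']]] := dOmega.
have [B OB] : exists B : R, forall x, Omega x -> `|x| <= B.
  by exists (B' + 1) => x Ox; apply: OB' => //; rewrite ltrDl.
apply/set0P/eqP => b0.
have cO : closed Omega.
  move=> x cx; apply: contrapT => nOx.
  have : boundary Omega x by split=> //; rewrite ((interior_id _).1 oO).
  by rewrite b0.
case: n n1 Omega oO cO x0 Ox0 B OB => // m _ O oO cO x0 Ox0 B OB.
pose e : 'rV[R]_m.+1 := const_mx 1.
pose f (t : R) := x0 + t *: e.
have cf : continuous f.
  move=> t; apply: cvgD; first exact: cvg_cst.
  exact: scalel_continuous.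
have fT : f @^-1` O = setT.
  have /connected_intervalP : is_interval (setT : set R) by [].
  apply.
  - by exists 0; rewrite /f /= scale0r addr0.
  - exists (f @^-1` O); last by rewrite setTI.
    by move/continuousP : cf; apply.
  - exists (f @^-1` O); last by rewrite setTI.
    by apply: closed_comp => // t _; exact: cf.
pose t : R := `|x0| + `|B| + 1.
have : (f @^-1` O) t by rewrite fT.
move=> /OB /=; rewrite /f => xt.
have := le_trans (norm_coord_le (x0 + t *: e) ord0) xt.
rewrite !mxE mulr1 => /(le_trans (ler_norm _)).
have := norm_coord_le x0 ord0; rewrite ler_norml => /andP[+ _].
by have := ler_norm B; rewrite /t; lra.
Qed.

Lemma bdist_le x z : boundary Omega z -> bdist Omega x <= enorm (x - z).
Proof.
move=> bz; apply: ge_inf; last by exists z.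
by exists 0 => _ [y _ <-]; exact: enorm_ge0.
Qed.

Lemma bdist_gt0 x : Omega x -> 0 < bdist Omega x.
Proof.
move=> Ox; have /nbhs_enormP[e e0 eO] := open_nbhs_nbhs (conj domain_open Ox).
apply: (lt_le_trans e0); apply: lb_le_inf.
  by have [z bz] := boundary_neq0; exists (enorm (x - z)), z.
move=> _ [z bz <-]; rewrite leNgt; apply/negP => xz.
by apply: (boundary_notin domain_open bz); apply: eO; rewrite enormBC.
Qed.

(** A near minimizer is enough. The factor [3 / 2] stays below 2, the ratio of the smallest dyadic
    radius to [bdist Omega x], and thereby leaves room for balls centred at [z]. *)
Lemma near_boundary_point x : Omega x ->
  exists2 z, boundary Omega z & enorm (x - z) < 3 / 2 * bdist Omega x.
Proof.
move=> Ox; have d0 := bdist_gt0 Ox.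
have d2 : 0 < bdist Omega x / 2 by lra.
have [] := @inf_adherent _ [set enorm (x - y) | y in boundary Omega] _ d2.
  split; first by have [z bz] := boundary_neq0; exists (enorm (x - z)), z.
  by exists 0 => _ [y _ <-]; exact: enorm_ge0.
move=> _ [z bz <-]; rewrite -/(bdist Omega x) => xz.
by exists z => //; lra.
Qed.

Lemma bdist_lipschitz x y : `|bdist Omega x - bdist Omega y| <= enorm (x - y).
Proof.
have le u v : bdist Omega u <= enorm (u - v) + bdist Omega v.
  rewrite -lerBlDl; apply: lb_le_inf.
    by have [z bz] := boundary_neq0; exists (enorm (v - z)), z.
  move=> _ [z bz <-]; rewrite lerBlDl.
  exact: le_trans (bdist_le u bz) (enormB _ _ _).
by rewrite ler_norml; have := le x y; have := le y x; rewrite enormBC => ? ?;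
  apply/andP; split; lra.
Qed.

Local Notation H A := (hausdorff_outer n.-1 A).
Local Notation ball_ w t :=
  (boundary Omega `&` [set y | (enorm (y - w) < t)%R]).

Hypothesis C11Omega : C11_boundary Omega.

(** Decreasing [k] weakens all three of its roles (radius, lower and upper constant), so the values
    found near each boundary point combine into one by compactness. *)
Lemma locally_ahlfors : exists2 k : R, 0 < k & forall w (t : R),
  boundary Omega w -> 0 < t <= k ->
  ((k * t ^+ n.-1)%:E <= H (ball_ w t))%E /\
  (H (ball_ w t) <= (k^-1 * t ^+ n.-1)%:E)%E.
Proof.
pose P (k : R) w := forall t : R, 0 < t <= k ->
  ((k * t ^+ n.-1)%:E <= H (ball_ w t))%E /\
  (H (ball_ w t) <= (k^-1 * t ^+ n.-1)%:E)%E.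
have /compact_near_coveringP/near_covering_withinP cover := compact_boundary.
have : \forall k \near 0^'+, boundary Omega `<=` P k.
  apply: (cover _ _ P) => z bz.
  have [r [Q [i [g [r0 QQ C11g chart]]]]] := C11Omega bz.
  have [k k0 kP] := chart_ahlfors domain_open r0 QQ C11g chart.
  exists ([set w | enorm (w - z) < k], [set k' | 0 < k' <= k]) => /=.
    split; first by apply/nbhs_enormP; exists k.
    near=> k' => /=; apply/andP; split; first by near: k'; exact: nbhs_right_gt.
    by near: k'; exact: nbhs_right_le.
  move=> [w k'] [/= wz /andP[k'0 k'k]] bw t /andP[t0 tk'].
  have [|lo up] := kP w t bw wz; first by rewrite t0 (le_trans tk').
  split.
    by apply: le_trans lo; rewrite lee_fin ler_pM2r ?exprn_gt0.
  apply: (le_trans up); rewrite lee_fin ler_pM2r ?exprn_gt0//.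
  by rewrite lef_pV2.
move=> nearP.
have [k [k0 kP]] := filter_ex (filterI (@nbhs_right_gt R 0) nearP).
by exists k => // w t bw tk; exact: kP.
Unshelve. all: by end_near. Qed.

Lemma boundary_finite : (H (boundary Omega) < +oo)%E.
Proof.
have [k k0 kP] := locally_ahlfors.
have := compact_boundary; rewrite compact_cover.
move=> /(_ _ (boundary Omega) (fun w => [set y | enorm (y - w) < k])).
case.
- move=> w bw; rewrite openE => y /= yw; apply/nbhs_enormP.
  exists (k - enorm (y - w)); first by rewrite subr_gt0.
  by move=> x xy; apply: (le_lt_trans (enormB _ y _)); lra.
- by move=> w bw; exists w => //=; rewrite subrr enorm0.
move=> D Dsub bD.
have bD' : boundary Omega `<=` \bigcup_(w in [set` D]) (ball_ w k).
  by move=> x bx; have [w Dw xw] := bD x bx; exists w.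
apply: (le_lt_trans (le_hausdorff_outer n.-1 bD')).
rewrite bigcup_seq.
have {Dsub} : forall w, w \in (enum_fset D) -> boundary Omega w.
  by move=> w /Dsub; exact: set_mem.
elim: (enum_fset D) => [|w s IH] sD.
  by rewrite big_nil hausdorff_outer0.
rewrite big_cons.
apply: (le_lt_trans (outer_measureU2 (hausdorff_outer_measure R n n.-1) _ _)).
have bw : boundary Omega w by apply: sD; rewrite mem_head.
apply: lte_add_pinfty.
  by apply: (le_lt_trans (kP w k bw _).2); rewrite ?k0 ?lexx ?ltey.
by apply: IH => v vs; apply: sD; rewrite in_cons vs orbT.
Qed.

(** Beyond the radius [k], monotonicity gives the lower bound up to [M] at the cost of
    [(k / M') ^ d], and the finite total mass [T] gives the upper bound at every scale. *)
Lemma ahlfors_regular (M : R) : exists2 k : R, 0 < k &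
  forall w, boundary Omega w ->
  (forall t, 0 < t <= M -> ((k * t ^+ n.-1)%:E <= H (ball_ w t))%E) /\
  (forall t, 0 < t -> (H (ball_ w t) <= (k^-1 * t ^+ n.-1)%:E)%E).
Proof.
have [k k0 kP] := locally_ahlfors.
set d := n.-1.
pose M' := Num.max M k; have M'0 : 0 < M' by rewrite lt_max k0 orbT.
have Hfin : H (boundary Omega) \is a fin_num.
  by rewrite ge0_fin_numE ?hausdorff_outer_ge0 ?boundary_finite.
pose T := fine (H (boundary Omega)).
have T0 : 0 <= T by apply: fine_ge0; exact: hausdorff_outer_ge0.
pose k1 := k * (k / M') ^+ d; pose k2 := k^-1 + T / k ^+ d.
have k10 : 0 < k1 by rewrite mulr_gt0// exprn_gt0// divr_gt0.
have k20 : 0 < k2 by rewrite ltr_pwDl ?invr_gt0// divr_ge0// exprn_ge0// ltW.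
have kM' : k / M' <= 1 by rewrite ler_pdivrMr// mul1r le_max lexx orbT.
exists (Num.min k1 k2^-1); first by rewrite lt_min k10 invr_gt0.
move=> w bw; split=> [t /andP[t0 tM]|t t0].
  apply: (@le_trans _ _ (k1 * t ^+ d)%:E).
    by rewrite lee_fin ler_pM2r ?exprn_gt0// ge_min lexx.
  have [tk|kt] := leP t k.
    have [|lo _] := kP w t bw; first by rewrite t0.
    apply: le_trans lo; rewrite lee_fin ler_pM2r ?exprn_gt0// ler_piMr//.
      exact: ltW.
    by rewrite exprn_ile1// divr_ge0// ltW.
  have [|lo _] := kP w k bw; first by rewrite k0 lexx.
  apply: (le_trans (le_trans _ lo)); last first.
    by apply: le_hausdorff_outer => y [by_ /= yw]; split=> //=;
      exact: lt_trans kt.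
  rewrite lee_fin /k1 -mulrA -exprMn ler_pM2l//.
  rewrite lerXn2r ?nnegrE ?mulr_ge0 ?invr_ge0 ?(ltW k0) ?(ltW t0) ?(ltW M'0)//.
  rewrite -mulrA ger_pMr// mulrC ler_pdivrMr// mul1r.
  by rewrite le_max tM.
apply: (@le_trans _ _ (k2 * t ^+ d)%:E); last first.
  rewrite lee_fin ler_pM2r ?exprn_gt0// -[leLHS]invrK lef_pV2 ?posrE
    ?invr_gt0//.
    by rewrite ge_min lexx orbT.
  by rewrite lt_min k10 invr_gt0.
have [tk|kt] := leP t k.
  have [|_ up] := kP w t bw; first by rewrite t0.
  apply: (le_trans up); rewrite lee_fin ler_pM2r ?exprn_gt0// lerDl.
  by rewrite divr_ge0// exprn_ge0// ltW.
apply: (@le_trans _ _ (H (boundary Omega)));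
  first by apply: le_hausdorff_outer => y [].
rewrite -(fineK Hfin) lee_fin -/T mulrDl.
apply: (@le_trans _ _ (T / k ^+ d * t ^+ d)); last first.
  by rewrite lerDr mulr_ge0 ?invr_ge0 ?exprn_ge0// ltW.
rewrite -mulrA ler_peMr// mulrC ler_pdivlMr ?exprn_gt0// mul1r.
by rewrite lerXn2r ?nnegrE// ltW.
Qed.

End Domain.

(** * Dyadic sums *)

Section DyadicSums.
Variable R : realType.
Implicit Types (a r p q M : R) (K : nat).

Lemma sum_geometric_le q K : 0 <= q < 1 -> \sum_(k < K) q ^+ k <= (1 - q)^-1.
Proof.
move=> /andP[q0 q1]; have q1' : 0 < 1 - q by rewrite subr_gt0.
rewrite -[leRHS]mul1r ler_pdivlMr// mulrC.
have := subrX1 q K; set S := \sum_(_ < _) _.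
have : 0 <= q ^+ K by exact: exprn_ge0.
by nra.
Qed.

(** [K] is the least exponent reaching [M]; it is not 0 because [r < M]. *)
Lemma dyadic_scale r M : 0 < r < M ->
  exists2 K, (0 < K)%N & M <= 2 ^+ K * r < 2 * M.
Proof.
move=> /andP[r0 rM].
have exK : exists K, M <= 2 ^+ K * r.
  exists (Num.truncn (M / r)).+1; rewrite -ler_pdivrMr//.
  apply: (le_trans (ltW (truncnS_gt _))); rewrite -natrX ler_nat.
  exact/ltnW/ltn_expl.
have := ex_minnP exK => -[[|K] MK Kmin]; first by move: MK; rewrite expr0; lra.
exists K.+1 => //; rewrite MK/= exprS -mulrA ltr_pM2l// ltNge.
by apply/negP => /Kmin; rewrite ltnn.
Qed.

Lemma powR2N_itv p : 0 < p -> 0 <= (2 : R) `^ (- p) < 1.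
Proof.
move=> p0; rewrite powR_ge0/= powRN invf_lt1 ?powR_gt0//.
by have := @gt0_ltr_powR R p p0 1 2; rewrite powR1; apply;
  rewrite ?nnegrE ?ltr1n.
Qed.

Lemma powR_dyadic (k : nat) r p : 0 <= r ->
  (2 ^+ k * r) `^ p = (2 `^ p) ^+ k * r `^ p.
Proof.
move=> r0; rewrite powRM ?exprn_ge0//; congr (_ * _).
have pow2 (x : R) : 0 <= x -> x `^ k%:R = x ^+ k by exact: powR_mulrn.
rewrite -[LHS]/((2 ^+ k) `^ p) -(pow2 2)//.
by rewrite -powRrM mulrC powRrM; exact/pow2/powR_ge0.
Qed.

Lemma le0_powR p a r : 0 <= p -> 0 < a -> a <= r -> r `^ (- p) <= a `^ (- p).
Proof.
move=> p0 a0 ar; have r0 := lt_le_trans a0 ar.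
by rewrite !powRN lef_pV2 ?posrE ?powR_gt0// ge0_ler_powR ?nnegrE// ltW.
Qed.

(** The terms that survive have radius above [a] and decay geometrically with ratio [2 ^ (- p)]. The
    induction doubles [r] until the first of them is reached. *)
Lemma dyadic_sum_le a r p K : 0 < p -> 0 < a -> 0 < r ->
  \sum_(k < K) (2 ^+ k.+1 * r) `^ (- p) * (a < 2 ^+ k.+1 * r)%R%:R <=
  (1 - 2 `^ (- p))^-1 * a `^ (- p).
Proof.
move=> p0 a0; have q01 := powR2N_itv p0; have /andP[q0 q1] := q01.
elim: K r => [|K IH] r r0.
  by rewrite big_ord0 mulr_ge0 ?powR_ge0// invr_ge0 subr_ge0 ltW.
have [ar|ra] := ltP a (2 * r).
  apply: (@le_trans _ _ (\sum_(k < K.+1) (2 `^ (- p)) ^+ k * a `^ (- p))).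
    apply: ler_sum => k _; rewrite -powR_dyadic ?(ltW a0)//.
    apply: (@le_trans _ _ ((2 ^+ k.+1 * r) `^ (- p))).
      by rewrite ler_piMr ?powR_ge0// lern1 leq_b1.
    apply: le0_powR; [exact: ltW|by rewrite mulr_gt0// exprn_gt0|].
    by rewrite exprSr -mulrA ler_pM2l ?exprn_gt0// ltW.
  by rewrite -mulr_suml ler_wpM2r ?powR_ge0// sum_geometric_le.
rewrite big_ord_recl/= expr1 ltNge ra mulr0 add0r.
under eq_bigr => k _ do rewrite /bump/= add1n exprSr -mulrA.
by apply: IH; rewrite mulr_gt0.
Qed.

(** One term suffices: the first dyadic radius exceeding [a] is at most [2 * a]. *)
Lemma dyadic_sum_ge a r p K : 0 < p -> 0 < r -> r <= a < 2 ^+ K * r ->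
  2 `^ (- p) * a `^ (- p) <=
  \sum_(k < K) (2 ^+ k.+1 * r) `^ (- p) * (a < 2 ^+ k.+1 * r)%R%:R.
Proof.
move=> p0; elim: K r => [|K IH] r r0 /andP[ra aK].
  by move: aK; rewrite expr0; lra.
rewrite big_ord_recl/= expr1.
have [ar|ra'] := ltP a (2 * r).
  rewrite mulr1 -[leLHS]addr0 lerD//.
    by rewrite powRM ?(ltW r0)// ler_wpM2l ?powR_ge0// le0_powR// ltW.
  by apply: sumr_ge0 => k _; rewrite mulr_ge0 ?powR_ge0.
rewrite mulr0 add0r.
under eq_bigr => k _ do rewrite /bump/= add1n exprSr -mulrA.
by apply: IH; rewrite ?mulr_gt0// ra' mulrA -exprSr.
Qed.

Lemma dyadic_sum_pos b r K : 0 < b -> 0 < r -> (0 < K)%N ->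
  2 `^ (- b) * r `^ (- b) <= \sum_(k < K) (2 ^+ k.+1 * r) `^ (- b) <=
  (1 - 2 `^ (- b))^-1 * r `^ (- b).
Proof.
move=> b0 r0 K0; have q01 := powR2N_itv b0; have /andP[q0 q1] := q01.
apply/andP; split.
  case: K K0 => // K _; rewrite big_ord_recl/= expr1 powRM ?(ltW r0)// lerDl.
  by apply: sumr_ge0 => k _; exact: powR_ge0.
apply: (@le_trans _ _ (\sum_(k < K) (2 `^ (- b)) ^+ k * r `^ (- b))).
  apply: ler_sum => k _; rewrite powR_dyadic ?(ltW r0)// ler_wpM2r ?powR_ge0//.
  by rewrite exprS ler_piMl ?exprn_ge0// ltW.
by rewrite -mulr_suml ler_wpM2r ?powR_ge0// sum_geometric_le.
Qed.

Lemma dyadic_sum_neg b r M K : 0 < b -> 0 < r -> 0 < M ->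
  M <= 2 ^+ K * r < 2 * M -> (0 < K)%N ->
  M `^ b <= \sum_(k < K) (2 ^+ k.+1 * r) `^ b <=
  (1 - 2 `^ (- b))^-1 * (2 * M) `^ b.
Proof.
move=> b0 r0 M0 /andP[MK KM] K0; have q01 := powR2N_itv b0;
  have /andP[q0 q1] := q01.
have Kr0 : 0 < 2 ^+ K * r by rewrite mulr_gt0// exprn_gt0.
apply/andP; split.
  case: K MK KM K0 Kr0 => // K MK KM _ Kr0; rewrite big_ord_recr/=.
  apply: (@le_trans _ _ ((2 ^+ K.+1 * r) `^ b)).
    by rewrite ge0_ler_powR ?nnegrE// ltW.
  by rewrite lerDr; apply: sumr_ge0 => k _; exact: powR_ge0.
rewrite (reindex_inj rev_ord_inj)/=.
apply: (@le_trans _ _ (\sum_(k < K) (2 `^ (- b)) ^+ k * (2 * M) `^ b)).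
  apply: ler_sum => k _.
  apply: (@le_trans _ _ ((2 `^ (- b)) ^+ k * (2 ^+ K * r) `^ b)).
    rewrite -subSn// subSS !powR_dyadic ?(ltW r0)// mulrA ler_wpM2r ?powR_ge0//.
    have E : (2 : R) `^ b ^+ K = (2 `^ b) ^+ k * (2 `^ b) ^+ (K - k).
      by rewrite -exprD subnKC// ltnW.
    by rewrite E mulrA -exprMn powRN mulVf ?gt_eqF ?powR_gt0// expr1n mul1r.
  rewrite ler_wpM2l ?exprn_ge0// ge0_ler_powR ?nnegrE ?(ltW b0) ?(ltW Kr0)
    ?(ltW KM)//.
  by rewrite mulr_ge0// ltW.
by rewrite -mulr_suml ler_wpM2r ?powR_ge0// sum_geometric_le.
Qed.

(** Taking logarithms, [K * ln 2 + ln r] lies between [ln M] and [ln (2 * M)], so [K * ln 2] and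
    [|ln r|] differ by at most [B]. This additive error becomes multiplicative because [K >= 1]; the
    two summands of [C] serve the two inequalities. *)
Lemma dyadic_log M : 0 < M -> exists2 C, 0 < C & forall r K, 0 < r ->
  M <= 2 ^+ K * r < 2 * M -> (0 < K)%N ->
  C^-1 * (1 + `|ln r|) <= K%:R <= C * (1 + `|ln r|).
Proof.
move=> M0; pose B := `|ln M| + `|ln (2 * M)|.
have B0 : 0 <= B by rewrite addr_ge0.
have l0 : 0 < ln 2 :> R by rewrite ln_gt0// ltr1n.
pose C := (B + 1) / ln 2 + (ln 2 + B + 1).
have D0 : 0 < (B + 1) / ln 2 by rewrite divr_gt0// ltr_wpDl.
have C0 : 0 < C by rewrite /C; lra.
exists C => // r K r0 /andP[MK KM] K0.
have K1 : 1 <= K%:R :> R by rewrite ler1n.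
have Kr0 : 0 < 2 ^+ K * r by rewrite mulr_gt0// exprn_gt0.
have lnK : ln (2 ^+ K * r) = K%:R * ln 2 + ln r.
  by rewrite lnM ?posrE ?exprn_gt0// lnXn// mulr_natl.
have lo : ln M <= K%:R * ln 2 + ln r by rewrite -lnK ler_ln ?posrE.
have hi : K%:R * ln 2 + ln r <= ln (2 * M).
  by rewrite -lnK ler_ln ?posrE ?mulr_gt0// ltW.
have bounds : K%:R * ln 2 <= B + `|ln r| /\ `|ln r| <= K%:R * ln 2 + B.
  have := ler_norm (ln M); have := ler_norm (- ln M); rewrite normrN => ? ?.
  have := ler_norm (ln (2 * M)); have := ler_norm (ln r).
  have := ler_norm (- ln r); rewrite normrN => ? ? ?.
  have ? := normr_ge0 (ln M); have ? := normr_ge0 (ln (2 * M)).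
  split; first by rewrite /B; lra.
  have K2 : (0 : R) <= K%:R * ln 2 by apply: mulr_ge0 => //; exact: ltW.
  by rewrite ler_norml /B; apply/andP; split; lra.
have [b1 b2] := bounds; have r1 := normr_ge0 (ln r).
apply/andP; split.
  rewrite ler_pdivrMl//; apply: (@le_trans _ _ ((ln 2 + B + 1) * K%:R));
    first by nra.
  by rewrite ler_wpM2r// /C; lra.
apply: (@le_trans _ _ ((B + 1) / ln 2 * (1 + `|ln r|))); last first.
  by rewrite ler_wpM2r// /C; lra.
by rewrite mulrAC ler_pdivlMr//; nra.
Qed.

(* With [b := 2 * gamma + 1 - 2 * s], the rate is [r ^ gamma] times the size of
   [\sum_(k < K) (2 ^ k.+1 * r) ^ (- b)], a sum dominated by its first term, by
   its last term, or by none, according to the sign of [b]. *)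
Lemma dyadic_sum_rate (s gamma : R) M : 0 < M ->
  exists2 C, 0 < C & forall r K,
  0 < r -> M <= 2 ^+ K * r < 2 * M -> (0 < K)%N ->
  let S := r `^ gamma *
    \sum_(k < K) (2 ^+ k.+1 * r) `^ (- (2 * gamma + 1 - 2 * s)) in
  let rate := if s - 2^-1 < gamma then r `^ (2 * s - gamma - 1)
    else if gamma == s - 2^-1 then r `^ gamma * (1 + `|ln r|)
    else r `^ gamma in
  C^-1 * rate <= S <= C * rate.
Proof.
move=> M0; set b := 2 * gamma + 1 - 2 * s.
(* Merges separate lower and upper constants into a single [C]. *)
have conclude (c1 c2 : R) : 0 < c1 -> 0 < c2 -> exists2 C, 0 < C &
    forall u v : R, 0 <= v -> c1 * v <= u <= c2 * v -> C^-1 * v <= u <= C * v.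
  move=> c10 c20; exists (c1^-1 + c2); first by rewrite addr_gt0 ?invr_gt0.
  move=> u v v0 /andP[lo hi]; apply/andP; split.
    apply: le_trans lo; rewrite ler_wpM2r// -[leRHS]invrK lef_pV2 ?posrE
      ?invr_gt0//.
      by rewrite lerDl ltW.
    by rewrite addr_gt0 ?invr_gt0.
  by apply: (le_trans hi); rewrite ler_wpM2r// lerDr invr_ge0 ltW.
case: ltgtP => [bpos|bneg|b0].
- have b0 : 0 < b by rewrite /b; lra.
  have /andP[q0 q1] := powR2N_itv b0.
  have [| |C C0 CP] := conclude (2 `^ (- b)) ((1 - 2 `^ (- b))^-1).
  + by rewrite powR_gt0.
  + by rewrite invr_gt0 subr_gt0.
  exists C => // r K r0 rK K0 /=; apply: CP; first exact: powR_ge0.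
  have -> : r `^ (2 * s - gamma - 1) = r `^ gamma * r `^ (- b).
    have -> : 2 * s - gamma - 1 = gamma + - b by rewrite /b; lra.
    by rewrite powRD// (gt_eqF r0) implybT.
  have /andP[lo hi] := dyadic_sum_pos b0 r0 K0.
  apply/andP; split; first by rewrite mulrCA ler_wpM2l ?powR_ge0.
  by rewrite [leRHS]mulrCA ler_wpM2l ?powR_ge0.
- have b0 : 0 < - b by rewrite /b; lra.
  have /andP[q0 q1] := powR2N_itv b0.
  have [| |C C0 CP] := conclude (M `^ (- b)) ((1 - 2 `^ (- - b))^-1 * (2 * M)
    `^ (- b)).
  + by rewrite powR_gt0.
  + by rewrite mulr_gt0 ?powR_gt0 ?mulr_gt0// invr_gt0 subr_gt0.
  exists C => // r K r0 rK K0 /=; apply: CP; first exact: powR_ge0.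
  have /andP[lo hi] := dyadic_sum_neg b0 r0 M0 rK K0.
  apply/andP; split; first by rewrite mulrC ler_wpM2l ?powR_ge0.
  by rewrite [leRHS]mulrC ler_wpM2l ?powR_ge0.
- have [C C0 CP] := dyadic_log M0.
  exists C => // r K r0 rK K0 /=.
  have bE : b = 0 by rewrite /b; lra.
  have /andP[lo hi] := CP r K r0 rK K0.
  rewrite bE oppr0 (eq_bigr (fun=> 1)); last by move=> k _; rewrite powRr0.
  rewrite sumr_const card_ord.
  apply/andP; split; first by rewrite mulrCA ler_wpM2l ?powR_ge0.
  by rewrite [leRHS]mulrCA ler_wpM2l ?powR_ge0.
Qed.

End DyadicSums.

(** * Surface integral of the kernel *)

(** The two iterated integrals define the same product measure, by uniqueness for sigma-finite
    factors. So [N] is null, and the measure of its other sections, having integral 0, vanishes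
    almost everywhere. *)
Lemma ysection_negligible d1 d2 (T1 : measurableType d1)
    (T2 : measurableType d2) (R : realType) (m1 : {sigma_finite_measure set T1 -> \bar R})
    (m2 : {sigma_finite_measure set T2 -> \bar R}) (N : set (T1 * T2)) :
  measurable N -> (forall z, m2 (xsection N z) = 0%E) ->
  {ae m2, forall x, m1 (ysection N x) = 0%E}.
Proof.
move=> mN N0.
have N1 : ((m1 \x m2) N = 0)%E.
  rewrite /product_measure1 (eq_integral (cst 0%E)) ?integral0// => z _.
  exact: N0.
have : ((m1 \x^ m2) N = 0)%E.
  rewrite -N1; apply/esym/product_measure_unique => // A B mA mB.
  exact: product_measure2E.
rewrite /product_measure2 => I0.
have : (\int[m2]_x `|(m1 \o ysection N) x| = 0)%E.
  by rewrite -[RHS]I0; apply: eq_integral => x _; rewrite gee0_abs.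
move/(ae_eq_integral_abs m2 measurableT (measurable_fun_ysection m1 mN)).
by apply: filterS => x /= /(_ I).
Qed.

Lemma integral_EFinM d (T : measurableType d) (R : realType)
    (mu : {measure set T -> \bar R}) (D : set T) (c : R) (f : T -> R) :
  measurable D -> measurable_fun D f -> (forall z, D z -> 0 <= f z) -> 0 <= c ->
  (\int[mu]_(z in D) (c * f z)%:E = c%:E * \int[mu]_(z in D) (f z)%:E)%E.
Proof.
move=> mD mf f0 c0; under eq_integral do rewrite EFinM.
by rewrite ge0_integralZl_EFin//; exact/measurable_EFinP.
Qed.

Lemma le_integral_EFin d (T : measurableType d) (R : realType)
    (mu : {measure set T -> \bar R}) (D : set T) (f g : T -> R) :
  measurable D -> measurable_fun D f -> measurable_fun D g ->
  (forall z, D z -> 0 <= f z <= g z) ->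
  (\int[mu]_(z in D) (f z)%:E <= \int[mu]_(z in D) (g z)%:E)%E.
Proof.
move=> mD mf mg fg; apply: ge0_le_integral => //.
- by move=> z /fg /andP[? _]; rewrite lee_fin.
- exact/measurable_EFinP.
- exact/measurable_EFinP.
- by move=> z /fg /andP[_ ?]; rewrite lee_fin.
Qed.

Section EuclideanMeasurability.
Variables (R : realType) (n : nat).

Lemma enorm_lipschitz_continuous (f : 'rV[R]_n -> R) :
  (forall x y, `|f x - f y| <= enorm (x - y)) -> continuous f.
Proof.
move=> fL x B /nbhs_ballP[e /= e0 eB]; apply/nbhs_enormP.
exists e => // y yx; apply: eB; rewrite /ball/= distrC.
exact: le_lt_trans (fL y x) yx.
Qed.

Lemma enorm_dist_lipschitz (w x y : 'rV[R]_n) :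
  `|enorm (w - x) - enorm (w - y)| <= enorm (x - y).
Proof.
have := enormB w x y; have := enormB w y x.
rewrite (enormBC y x) ler_norml => ? ?; apply/andP; split; lra.
Qed.

Lemma measurable_lebesgue_continuous (f : 'rV[R]_n -> R) :
  continuous f -> measurable_fun (setT : set (lebesgueType R n)) f.
Proof.
move=> cf; apply: continuous_caratheodory_measurable cf.
exact: lebesgue_halfspace.
Qed.

Lemma measurable_hausdorff_continuous d (f : 'rV[R]_n -> R) :
  continuous f -> measurable_fun (setT : set (hausdorffType R n d)) f.
Proof.
move=> cf; apply: continuous_caratheodory_measurable cf.
exact: hausdorff_halfspace.
Qed.

Lemma open_lebesgue_measurable (U : set 'rV[R]_n) :
  open U -> measurable (U : set (lebesgueType R n)).
Proof. move=> oU; apply: open_caratheodory oU; exact: lebesgue_halfspace. Qed.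

Lemma open_hausdorff_measurable d (U : set 'rV[R]_n) :
  open U -> measurable (U : set (hausdorffType R n d)).
Proof. move=> oU; apply: open_caratheodory oU; exact: hausdorff_halfspace. Qed.

Lemma closed_hausdorff_measurable d (U : set 'rV[R]_n) :
  closed U -> measurable (U : set (hausdorffType R n d)).
Proof.
move=> cU; rewrite -[U]setCK; apply: measurableC.
exact/open_hausdorff_measurable/closed_openC.
Qed.

Lemma open_enorm_ball (x : 'rV[R]_n) t : open [set z | enorm (x - z) < t].
Proof.
rewrite openE => y /= xy; apply/nbhs_enormP.
exists (t - enorm (x - y)); first by rewrite subr_gt0.
by move=> z yz; have := enormB x y z; rewrite (enormBC y z) /=; lra.
Qed.

(** The sigma-algebra here is a product of two different Carathéodory sigma-algebras, so
    measurability is built from the coordinates of each factor. *)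
Lemma measurable_pair_enorm d :
  measurable_fun (setT : set (hausdorffType R n d * lebesgueType R n))
    (fun q => enorm (q.1 - q.2)).
Proof.
have coord (i : 'I_n) : measurable_fun
    (setT : set (hausdorffType R n d * lebesgueType R n))
    (fun q => (q.1 ord0 i - q.2 ord0 i) ^+ 2).
  apply: measurable_funX; apply: measurable_funB.
    apply: (measurableT_comp (f := fun z : hausdorffType R n d => z ord0 i)).
      exact/measurable_hausdorff_continuous/coord_continuous.
    exact: measurable_fst.
  apply: (measurableT_comp (f := fun z : lebesgueType R n => z ord0 i)).
    exact/measurable_lebesgue_continuous/coord_continuous.
  exact: measurable_snd.
have -> : (fun q : hausdorffType R n d * lebesgueType R n => enorm (q.1 - q.2))
  =
    (fun q => Num.sqrt (\sum_i (q.1 ord0 i - q.2 ord0 i) ^+ 2)).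
  by apply/funext => q; rewrite /enorm; congr Num.sqrt; apply: eq_bigr => i _;
    rewrite !mxE.
apply: (measurableT_comp (continuous_measurable_fun (@sqrt_continuous R))).
exact: measurable_sum.
Qed.

End EuclideanMeasurability.

Section SurfaceIntegral.
Variables (R : realType) (n : nat) (Omega : set 'rV[R]_n).
Hypotheses (n1 : (1 <= n)%N) (dOmega : bounded_domain Omega).
Hypothesis C11Omega : C11_boundary Omega.
Variables (s gamma : R).
Hypotheses (gamma0 : 0 < gamma) (sn : 2 * s <= n%:R).

Local Notation p := (n%:R - 2 * s + 2 * gamma).
Local Notation sigma := (surface_measure R n).

Lemma measurable_surface_kernel (x : 'rV[R]_n) (c : R) :
  measurable_fun (boundary Omega : set (surfaceType R n))
    (fun z => c * enorm (x - z) `^ (- p)).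
Proof.
apply: measurable_funTS; apply: measurable_funM; first exact: measurable_cst.
apply: (measurableT_comp (measurable_powR _)).
apply/measurable_hausdorff_continuous/enorm_lipschitz_continuous => z z'.
exact: enorm_dist_lipschitz.
Qed.

Lemma surface_kernel_integral : exists2 C : R, 0 < C & forall x, Omega x ->
  ((C^-1 * u_star_rate Omega s gamma x)%:E <=
    \int[sigma]_(z in boundary Omega)
      (bdist Omega x `^ gamma * enorm (x - z) `^ (- p))%:E <=
   (C * u_star_rate Omega s gamma x)%:E)%E.
Proof.
have p0 : 0 < p by rewrite ltr_wpDl ?subr_ge0 ?mulr_gt0.
have [M M0 OM] := domain_diam dOmega.
have [C1 C10 rateP] := dyadic_sum_rate s gamma M0.
(* All dyadic radii used below are less than [2 * M], while the largest is at least [M] and so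
   exceeds every distance from [x] to the boundary. *)
have [k k0 kP] := ahlfors_regular dOmega C11Omega (2 * M).
pose q : R := 2 `^ (- p).
have /andP[_ q1] : 0 <= q < 1 := powR2N_itv p0.
have q0 : 0 < q by rewrite powR_gt0.
have q1' : 0 < 1 - q by rewrite subr_gt0.
pose B (x : 'rV[R]_n) t : set (surfaceType R n) := [set z | enorm (x - z) < t].
have mB x t : measurable (B x t) by
  exact/open_hausdorff_measurable/open_enorm_ball.
have mb : measurable (boundary Omega : set (surfaceType R n)).
  exact/closed_hausdorff_measurable/closed_boundary.
(* The factors come from moving the centre from [x] to the boundary point [z0]. Since [enorm (x -
   z0) < 3 / 2 * r <= 3 / 4 * t j], the ball of radius [t j] about [x] contains the one of radius
   [t j / 4] about [z0] and lies in the one of radius [2 * t j]. *)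
pose a1 := k * (4^-1) ^+ n.-1; pose a2 := k^-1 * 2 ^+ n.-1.
have a10 : 0 < a1 by rewrite mulr_gt0// exprn_gt0.
have a20 : 0 < a2 by rewrite mulr_gt0 ?invr_gt0// exprn_gt0.
pose cl := C1^-1 * (1 - q) * a1; pose cu := C1 * q^-1 * a2.
have cl0 : 0 < cl by rewrite !mulr_gt0// invr_gt0.
have cu0 : 0 < cu by rewrite !mulr_gt0// invr_gt0.
exists (cl^-1 + cu); first by rewrite addr_gt0// invr_gt0.
move=> x Ox; set r := bdist Omega x.
have r0 : 0 < r by exact: bdist_gt0.
have rM : r < M.
  have [z bz] := boundary_neq0 n1 dOmega.
  exact: le_lt_trans (bdist_le x bz) (OM _ _ Ox bz).
have [K K0 rK] : exists2 K, (0 < K)%N & M <= 2 ^+ K * r < 2 * M.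
  by apply: dyadic_scale; rewrite r0.
have /andP[MK KM] := rK.
have [z0 bz0 xz0] := near_boundary_point n1 dOmega Ox.
pose t k := 2 ^+ k.+1 * r.
have t0 j : 0 < t j by rewrite mulr_gt0// exprn_gt0.
have tr j : 2 * r <= t j.
  by rewrite ler_pM2r// exprS ler_peMr// exprn_ege1// ler1n.
have tM j : (j < K)%N -> t j < 2 * M.
  move=> jK; apply: le_lt_trans KM; rewrite ler_pM2r// ler_weXn2l// ler1n//.
have sigma_lo j : (j < K)%N -> ((a1 * t j ^+ n.-1)%:E <= sigma (B x (t j) `&`
  boundary Omega))%E.
  move=> /tM jM; have [lo _] := kP z0 bz0.
  have t4 : 0 < t j / 4 <= 2 * M by apply/andP; split; have := t0 j; lra.
  have := lo _ t4; rewrite exprMn mulrA [k * _ * _]mulrAC => /le_trans; apply.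
  apply: le_hausdorff_outer => z [bz /= zz0]; split=> //=.
  rewrite /B/=; have := enormB x z0 z; rewrite (enormBC z0 z).
  by have := tr j; lra.
have sigma_hi j : (sigma (B x (t j) `&` boundary Omega) <= (a2 * t j ^+
  n.-1)%:E)%E.
  have [_ hi] := kP z0 bz0.
  have t2 : 0 < 2 * t j by rewrite mulr_gt0.
  apply: (le_trans (le_trans _ (hi _ t2))); last by rewrite exprMn mulrA.
  apply: le_hausdorff_outer => z [/= xz bz]; split=> //=.
  have := enormB z x z0; rewrite (enormBC z x).
  by have := tr j; move: xz; rewrite /B/=; lra.
pose f z := enorm (x - z) `^ (- p).
pose g z := \sum_(j < K) (t j) `^ (- p) * \1_(B x (t j)) z.
have gE z : g z = \sum_(j < K) (2 ^+ j.+1 * r) `^ (- p) * (enorm (x - z) < 2 ^+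
  j.+1 * r)%R%:R.
  by apply: eq_bigr => j _; rewrite indicE mem_setE.
have fg_lo z : boundary Omega z -> g z <= (1 - q)^-1 * f z.
  move=> bz; rewrite gE; apply: dyadic_sum_le => //.
  exact: lt_le_trans r0 (bdist_le x bz).
have fg_hi z : boundary Omega z -> q * f z <= g z.
  move=> bz; rewrite gE; apply: dyadic_sum_ge => //.
  by rewrite (bdist_le x bz)/= (lt_le_trans (OM _ _ Ox bz)).
have f0 z : 0 <= f z by exact: powR_ge0.
have g0 z : 0 <= g z by apply: sumr_ge0 => j _; rewrite mulr_ge0 ?powR_ge0.
have mf : measurable_fun (boundary Omega : set (surfaceType R n)) f.
  by have := measurable_surface_kernel x 1; under eq_fun do rewrite mul1r.
have mg : measurable_fun (boundary Omega : set (surfaceType R n)) g.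
  apply: measurable_sum => j; apply: measurable_funM;
    first exact: measurable_cst.
  exact: measurable_indic.
pose S := \sum_(j < K) (t j) `^ (- (2 * gamma + 1 - 2 * s)).
(* The weight [t ^ (- p)] times the mass [t ^ (n - 1)] leaves the exponent that decides between the
   three rates. *)
have tS j : (t j) `^ (- p) * t j ^+ n.-1 = (t j) `^ (- (2 * gamma + 1 - 2 * s)).
  rewrite -powR_mulrn ?(ltW (t0 j))// -powRD;
    last by rewrite (gt_eqF (t0 j)) implybT.
  congr (_ `^ _); rewrite -[in n%:R](prednK n1) -natr1; ring.
have intg : (\int[sigma]_(z in boundary Omega) (g z)%:E =
    \sum_(j < K) ((t j) `^ (- p))%:E * sigma (B x (t j) `&` boundary Omega))%E.
  pose h (j : 'I_K) (z : surfaceType R n) : \bar R :=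
    ((t j) `^ (- p) * \1_(B x (t j)) z)%:E.
  have mh j : measurable_fun (boundary Omega : set (surfaceType R n)) (h j).
    apply/measurable_EFinP; apply: measurable_funM; first exact: measurable_cst.
    exact: measurable_indic.
  have h0 j z : boundary Omega z -> (0 <= h j z)%E.
    by move=> _; rewrite lee_fin mulr_ge0 ?powR_ge0.
  have -> : (fun z => (g z)%:E) = (fun z => \sum_(j <- index_enum 'I_K) h j
    z)%E.
    by apply/funext => z; rewrite /g -sumEFin.
  rewrite (@ge0_integral_sum _ _ _ sigma _ mb _ h mh h0).
  apply: eq_bigr => j _; rewrite -(integral_indic sigma mb (mB x (t j))).
  apply: (integral_EFinM sigma mb); [|by []|exact: powR_ge0].
  exact: measurable_indic (mB x (t j)).
have intg_lo : ((a1 * S)%:E <= \int[sigma]_(z in boundary Omega) (g z)%:E)%E.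
  rewrite intg /S mulr_sumr -sumEFin; apply: lee_sum => j _.
  rewrite -tS mulrCA EFinM; apply: lee_wpmul2l;
    first by rewrite lee_fin powR_ge0.
  exact: sigma_lo.
have intg_hi : (\int[sigma]_(z in boundary Omega) (g z)%:E <= (a2 * S)%:E)%E.
  rewrite intg /S mulr_sumr -sumEFin; apply: lee_sum => j _.
  rewrite -tS mulrCA EFinM; apply: lee_wpmul2l;
    first by rewrite lee_fin powR_ge0.
  exact: sigma_hi.
have intf (c : R) : 0 <= c -> (\int[sigma]_(z in boundary Omega) (c * f z)%:E =
    c%:E * \int[sigma]_(z in boundary Omega) (f z)%:E)%E.
  exact: (integral_EFinM sigma mb mf (fun z _ => f0 z)).
rewrite (intf _ (powR_ge0 _ _)).
pose If := (\int[sigma]_(z in boundary Omega) (f z)%:E)%E.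
have intf_lo : (\int[sigma]_(z in boundary Omega) ((1 - q)^-1 * f z)%:E =
    (1 - q)^-1%:E * If)%E by apply: intf; rewrite invr_ge0 ltW.
have intf_hi : (\int[sigma]_(z in boundary Omega) (q * f z)%:E = q%:E * If)%E.
  by apply: intf; exact: ltW.
rewrite -/If.
have If_lo : (((1 - q) * a1 * S)%:E <= If)%E.
  have : (\int[sigma]_(z in boundary Omega) (g z)%:E <= (1 - q)^-1%:E * If)%E.
    rewrite -intf_lo; apply: (le_integral_EFin sigma mb mg).
      exact: measurable_funM (measurable_cst _) mf.
    by move=> z bz; rewrite g0 fg_lo.
  move=> /(le_trans intg_lo)/(@lee_wpmul2l _ (1 - q)%:E).
  rewrite lee_fin => /(_ (ltW q1')).
  by rewrite muleA -!EFinM mulrA mulfV ?gt_eqF// mul1e.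
have If_hi : (If <= (q^-1 * a2 * S)%:E)%E.
  have : (q%:E * If <= \int[sigma]_(z in boundary Omega) (g z)%:E)%E.
    rewrite -intf_hi; apply: (le_integral_EFin sigma mb _ mg).
      exact: measurable_funM (measurable_cst _) mf.
    by move=> z bz; rewrite fg_hi// mulr_ge0// ltW.
  move=> /le_trans/(_ intg_hi)/(@lee_wpmul2l _ q^-1%:E).
  rewrite lee_fin invr_ge0 => /(_ (ltW q0)).
  by rewrite muleA -!EFinM mulrA mulVf ?gt_eqF// mul1e.
have := rateP r K r0 rK K0; rewrite /= -/(u_star_rate Omega s gamma x) -/S.
set rate := u_star_rate _ _ _ _ => /andP[rate_lo rate_hi].
have rate0 : 0 <= rate.
  rewrite /rate /u_star_rate; case: ifP => _; first exact: powR_ge0.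
  by case: ifP => _; rewrite ?mulr_ge0 ?powR_ge0.
apply/andP; split.
  apply: (@le_trans _ _ ((r `^ gamma)%:E * ((1 - q) * a1 * S)%:E)%E);
    last first.
    by apply: lee_wpmul2l => //; rewrite lee_fin powR_ge0.
  rewrite -EFinM lee_fin; apply: (@le_trans _ _ (cl * rate)).
    rewrite ler_wpM2r// -[leRHS]invrK lef_pV2 ?posrE ?invr_gt0//.
      by rewrite lerDl ltW.
    by rewrite addr_gt0// invr_gt0.
  have := ler_wpM2l (ltW (mulr_gt0 q1' a10)) rate_lo.
  by rewrite /cl; lra.
apply: (@le_trans _ _ ((r `^ gamma)%:E * (q^-1 * a2 * S)%:E)%E).
  by apply: lee_wpmul2l => //; rewrite lee_fin powR_ge0.
rewrite -EFinM lee_fin; apply: (@le_trans _ _ (cu * rate)); last first.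
  by rewrite ler_wpM2r// lerDr invr_ge0 ltW.
have qa : 0 <= q^-1 * a2 by rewrite mulr_ge0 ?invr_ge0// ltW.
have := ler_wpM2l qa rate_hi.
rewrite /cu; lra.
Qed.

End SurfaceIntegral.

(** * Boundary values of the Green kernel *)

(* The integrand may be negative on a null set, so it is replaced by its
   truncation between the two bounds. *)
Lemma integral_ae_bounds d (T : measurableType d) (R : realType)
    (mu : {measure set T -> \bar R}) (D N : set T) (f lo hi : T -> R) :
  measurable D -> measurable_fun D f -> measurable_fun D lo ->
  measurable_fun D hi -> (forall z, D z -> 0 <= lo z <= hi z) ->
  measurable N -> mu N = 0%E ->
  (forall z, D z -> ~ N z -> lo z <= f z <= hi z) ->
  (\int[mu]_(z in D) (lo z)%:E <= \int[mu]_(z in D) (f z)%:E <=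
   \int[mu]_(z in D) (hi z)%:E)%E.
Proof.
move=> mD mf mlo mhi lohi mN N0 fN.
pose h z := Num.max (lo z) (Num.min (f z) (hi z)).
have mh : measurable_fun D h.
  by apply: measurable_maxr => //; exact: measurable_minr.
have hlohi z : D z -> lo z <= h z <= hi z.
  move=> Dz; have /andP[_ lh] := lohi z Dz.
  by rewrite /h le_max lexx/= ge_max lh ge_min lexx orbT.
have -> : (\int[mu]_(z in D) (f z)%:E = \int[mu]_(z in D) (h z)%:E)%E.
  apply: ae_eq_integral => //; [exact/measurable_EFinP|exact/measurable_EFinP|].
  exists N; split=> // z /= nfh; apply: contrapT => Nz; apply: nfh => Dz.
  have /andP[fl fh] := fN z Dz Nz.
  by rewrite /h (min_idPl fh) (max_idPr fl).
apply/andP; split; apply: (le_integral_EFin mu mD) => // z Dz.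
  by have /andP[-> _] := lohi z Dz; have /andP[-> _] := hlohi z Dz.
have /andP[lo0 _] := lohi z Dz; have /andP[lh ->] := hlohi z Dz.
by rewrite (le_trans lo0 lh).
Qed.

Lemma continuous_powR_at (R : realType) (a r : R) : 0 < a ->
  {for a, continuous (fun x : R => x `^ r)}.
Proof.
move=> a0; apply: differentiable_continuous; apply/derivable1_diffP.
by apply: derivable_powR; rewrite in_itv/= a0.
Qed.

Section NormalDerivative.
Variables (R : realType) (n : nat) (Omega : set 'rV[R]_n).
Variables (s gamma : R) (G D : 'rV[R]_n -> 'rV[R]_n -> R).
Hypotheses (n1 : (1 <= n)%N) (dOmega : bounded_domain Omega).
Hypotheses (greenG : green_kernel Omega s gamma G)
  (normalD : normal_derivative Omega gamma G D).

Local Notation p := (n%:R - 2 * s + 2 * gamma).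

(* Near the boundary the minimum in the Green bound is its first argument. *)
Lemma normal_derivative_bounds : exists2 C : R, 1 <= C &
  forall z, boundary Omega z -> {ae lebesgue_n R n, forall y, Omega y ->
    C^-1 * (bdist Omega y `^ gamma * enorm (y - z) `^ (- p)) <= D z y <=
    C * (bdist Omega y `^ gamma * enorm (y - z) `^ (- p))}.
Proof.
have [C0 C00 CG] := green_comparable greenG.
(* [C >= 1] ensures that the lower bound is at most the upper one, as the truncation argument for
   the integral requires. *)
exists (Num.max C0 1); first by rewrite le_max lexx orbT.
set C := Num.max C0 1.
have C1 : 1 <= C by rewrite le_max lexx orbT.
have Cpos : 0 < C by lra.
move=> z bz.
have oO := domain_open dOmega.
have [/closure_enormP cz _] := bz.
(* A single sequence tending to [z] is enough, since the limit is [D z] along each of them. *)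
have /choice[x xP] : forall j : nat, exists x, Omega x /\ enorm (x - z) <
  j.+1%:R^-1.
  move=> j; have [|x Ox xz] := cz j.+1%:R^-1; last by exists x.
  by rewrite invr_gt0.
have Ox j : Omega (x j) by have [] := xP j.
have near_e (e : R) : 0 < e -> \forall j \near \oo, enorm (x j - z) < e.
  move=> e0; near=> j; apply: (@lt_trans _ _ j.+1%:R^-1);
    first by have [] := xP j.
  near: j; exact: (near_infty_natSinv_lt (PosNum e0)).
have xz : x @ \oo --> z.
  by move=> B /nbhs_enormP[e e0 eB]; near=> j; apply: eB; near: j;
    exact: near_e.
have := normal_derivative_cvg normalD bz Ox xz.
have aeF := ae_filter_ringOfSetsType (lebesgue_n R n).
apply: filterS => y cvgD Oy; have {}cvgD := cvgD Oy.
set dy := bdist Omega y.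
have dy0 : 0 < dy by exact: bdist_gt0.
set a := enorm (y - z).
have a0 : 0 < a.
  rewrite enorm_gt0 subr_eq0; apply/eqP => yz.
  by apply: (boundary_notin oO bz); rewrite -yz.
pose aj j := enorm (y - x j).
have aj_cvg : aj j @[j --> \oo] --> a.
  apply/cvgrPdist_lt => e e0; near=> j.
  apply: (@le_lt_trans _ _ (enorm (x j - z))).
    by rewrite distrC; exact: enorm_dist_lipschitz.
  by near: j; exact: near_e.
pose b j := dy `^ gamma * aj j `^ (- p).
have b_cvg : b j @[j --> \oo] --> dy `^ gamma * a `^ (- p).
  apply: cvgM; first exact: cvg_cst.
  exact: (cvg_comp aj (fun t => t `^ (- p)) aj_cvg (continuous_powR_at a0)).
have bounds : \forall j \near \oo,
    C^-1 * b j <= G (x j) y / bdist Omega (x j) `^ gamma <= C * b j.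
  near=> j.
  have xa : enorm (x j - z) < a / 2 by near: j; apply: near_e; rewrite divr_gt0.
  (* This gives [dx * dy <= (a / 2) ^ 2 <= aj j ^ 2], which makes the first argument of the minimum
     the smaller one. *)
  have xd : enorm (x j - z) < (a / 2) ^+ 2 / dy.
    by near: j; apply: near_e; rewrite divr_gt0// exprn_gt0// divr_gt0.
  have aja : a / 2 <= aj j.
    have := enorm_dist_lipschitz y (x j) z; rewrite -/a -/(aj j) ler_norml.
    by move=> /andP[? ?]; lra.
  have aj0 : 0 < aj j by lra.
  set dx := bdist Omega (x j).
  have dx0 : 0 < dx by exact: bdist_gt0.
  have dxz : dx <= enorm (x j - z) by exact: bdist_le.
  have xy : x j != y by rewrite eq_sym -subr_eq0 -enorm_gt0.
  have := CG (x j, y) => /= /(_ (And3 (Ox j) Oy xy)).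
  rewrite /green_bound -/dx -/dy (enormBC (x j) y) -/(aj j).
  have -> : Num.min (dx * dy / aj j ^+ 2) 1 = dx * dy / aj j ^+ 2.
    apply/min_idPl; rewrite ler_pdivrMr ?exprn_gt0// mul1r.
    apply: (@le_trans _ _ ((a / 2) ^+ 2)).
      by rewrite -ler_pdivlMr// ltW// (le_lt_trans dxz).
    by rewrite lerXn2r ?nnegrE// ltW// divr_gt0.
  (* The minimum contributes [aj ^ (- 2 gamma)], completing the exponent [- p], and isolates the
     factor [dx ^ gamma] that the normalization of [G] divides out. *)
  have -> : (aj j `^ (n%:R - 2 * s))^-1 * (dx * dy / aj j ^+ 2) `^ gamma =
      dx `^ gamma * b j.
    rewrite /b !powRM ?mulr_ge0 ?invr_ge0 ?exprn_ge0 ?(ltW dx0) ?(ltW dy0)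
      ?(ltW aj0)//.
    have -> : ((aj j ^+ 2)^-1) `^ gamma = aj j `^ (- (2 * gamma)).
      by rewrite -powR_inv1 ?exprn_ge0 ?(ltW aj0)// -powRrM -powR_mulrn ?(ltW
        aj0)//
        -powRrM; congr (_ `^ _); ring.
    have -> : aj j `^ (- p) = aj j `^ (- (n%:R - 2 * s)) * aj j `^ (- (2 *
      gamma)).
      by rewrite -powRD ?(gt_eqF aj0) ?implybT//; congr (_ `^ _); ring.
    by rewrite [aj j `^ (- (n%:R - 2 * s))]powRN mulrCA -mulrA.
  have b0 : 0 <= b j by rewrite mulr_ge0 ?powR_ge0.
  have dxg : 0 < dx `^ gamma by rewrite powR_gt0.
  move=> /andP[Glo Ghi]; apply/andP; split.
    rewrite ler_pdivlMr// -mulrA [b j * _]mulrC; apply: le_trans Glo.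
    apply: ler_wpM2r; first exact: mulr_ge0 (ltW dxg) b0.
    by rewrite lef_pV2 ?posrE// /C le_max lexx.
  rewrite ler_pdivrMr// -mulrA [b j * _]mulrC; apply: (le_trans Ghi).
  apply: ler_wpM2r; first exact: mulr_ge0 (ltW dxg) b0.
  by rewrite /C le_max lexx.
apply/andP; split.
  apply: (ler_cvg_to (cvgM (cvg_cst C^-1) b_cvg) cvgD).
  by apply: filterS bounds => j /andP[].
apply: (ler_cvg_to cvgD (cvgM (cvg_cst C) b_cvg)).
by apply: filterS bounds => j /andP[].
Unshelve. all: by end_near. Qed.

End NormalDerivative.

Section PoissonBounds.
Variables (R : realType) (n : nat) (Omega : set 'rV[R]_n).
Variables (s gamma : R) (G D : 'rV[R]_n -> 'rV[R]_n -> R).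
Hypotheses (n1 : (1 <= n)%N) (dOmega : bounded_domain Omega).
Hypothesis C11Omega : C11_boundary Omega.
Hypotheses (greenG : green_kernel Omega s gamma G)
  (normalD : normal_derivative Omega gamma G D).

Local Notation p := (n%:R - 2 * s + 2 * gamma).
Local Notation sigma := (surface_measure R n).
Local Notation lambda := (lebesgue_n R n).

Lemma lebesgue_domain_finite : (lambda Omega < +oo)%E.
Proof.
have [_ _ _ [B [_ OB]]] := dOmega.
pose K := `|B| + 1.
have OK x : Omega x -> `|x| <= K.
  move=> Ox; apply: OB => //; rewrite /K.
  by apply: (le_lt_trans (ler_norm B)); rewrite ltrDl.
have K0 : 0 <= K by rewrite addr_ge0.
(* The lower corner is shifted by 1 because boxes are open on that side. *)
pose a : 'rV[R]_n := const_mx (- (K + 1)); pose b : 'rV[R]_n := const_mx K.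
have ab i : a ord0 i <= b ord0 i by rewrite !mxE; lra.
apply: (@le_lt_trans _ _ (lebesgue_outer (box_set (Some (a, b))))).
  apply: le_cover_outer => x /OK xK i; rewrite !mxE.
  have := le_trans (norm_coord_le x i) xK; rewrite ler_norml => /andP[? ?].
  by apply/andP; split; lra.
by rewrite lebesgue_outer_box//= ltey.
Qed.

Let kernel (q : 'rV[R]_n * 'rV[R]_n) : R :=
  bdist Omega q.2 `^ gamma * enorm (q.2 - q.1) `^ (- p).

Let domain : set (surfaceType R n * lebesgueType R n) :=
  boundary Omega `*` Omega.

Let measurable_domain : measurable domain.
Proof.
apply: measurableX.
  exact/closed_hausdorff_measurable/closed_boundary.
exact/open_lebesgue_measurable/domain_open.
Qed.

Let measurable_kernel (c : R) : measurable_fun domain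
  (fun q : surfaceType R n * lebesgueType R n => c * kernel q).
Proof.
apply: measurable_funTS; apply: measurable_funM; first exact: measurable_cst.
apply: measurable_funM.
  apply: (measurableT_comp (measurable_powR _)).
  apply: (measurableT_comp (f := fun y : lebesgueType R n => bdist Omega y)).
    apply/measurable_lebesgue_continuous/enorm_lipschitz_continuous => x y.
    exact: bdist_lipschitz.
  exact: measurable_snd.
apply: (measurableT_comp (measurable_powR _)).
have -> : (fun q : surfaceType R n * lebesgueType R n => enorm (q.2 - q.1)) =
    (fun q => enorm (q.1 - q.2)) by apply/funext => q; exact: enormBC.
exact: measurable_pair_enorm.
Qed.

(** For each [z] the bounds fail on a null set of [x] that depends on [z]. The set of failing pairs
    is measurable in the product, so Tonelli turns this into a null set of [z] for almost every [x],
    the form that integration over the boundary can use. *)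
Lemma ae_normal_derivative_bounds : exists2 C : R, 1 <= C &
  {ae lambda, forall x, Omega x -> exists N : set (surfaceType R n),
    [/\ measurable N, sigma N = 0%E & forall z, boundary Omega z -> ~ N z ->
      C^-1 * kernel (z, x) <= D z x <= C * kernel (z, x)]}.
Proof.
have [C C1 CD] := normal_derivative_bounds n1 dOmega greenG normalD.
exists C => //.
pose Df (q : surfaceType R n * lebesgueType R n) := D q.1 q.2.
have mD : measurable_fun domain Df := normal_derivative_measurable normalD.
pose N := (domain `&` (fun q => Df q < C^-1 * kernel q) @^-1` [set true]) `|`
  (domain `&` (fun q => C * kernel q < Df q) @^-1` [set true]).
have mN : measurable N.
  apply: measurableU.
    exact: (measurable_fun_ltr mD (measurable_kernel C^-1)).
  exact: (measurable_fun_ltr (measurable_kernel C) mD).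
have mb : measurable (boundary Omega : set (surfaceType R n)).
  exact/closed_hausdorff_measurable/closed_boundary.
have mO : measurable (Omega : set (lebesgueType R n)).
  exact/open_lebesgue_measurable/domain_open.
have bfin : (sigma (boundary Omega) < +oo)%E by exact: boundary_finite.
(* Restricting to the boundary is essential: the surface measure is not sigma-finite on the whole
   space. *)
pose m1 : {finite_measure set (surfaceType R n) -> \bar R} := mfrestr mb bfin.
pose m2 : {finite_measure set (lebesgueType R n) -> \bar R} :=
  mfrestr mO lebesgue_domain_finite.
have N0 z : m2 (xsection N z) = 0%E.
  rewrite /m2 /= /mfrestr /mrestr.
  have [bz|nbz] := pselect (boundary Omega z); last first.
    rewrite (_ : _ `&` _ = set0) ?measure0//; apply/seteqP; split=> // y [+ _].
    by rewrite /xsection/= inE => -[[[]]|[[]]].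
  apply: (@measure_negligible _ _ _ (lebesgue_n R n)).
    by apply: measurableI => //; exact: measurable_xsection.
  apply: negligibleS (CD z bz) => y [+ Oy] /= /(_ Oy).
  rewrite /xsection/= inE => -[[_ /=]|[_ /=]];
    rewrite /Df /kernel/= => lt1 /andP[h1 h2].
    by move: lt1; rewrite ltNge h1.
  by move: lt1; rewrite ltNge h2.
have [A [mA A0 NA]] := @ysection_negligible _ _ (surfaceType R n) (lebesgueType
  R n) R m1 m2 N mN N0.
exists (A `&` Omega); split; [exact: measurableI|exact: A0|].
move=> x /= nx; apply: contrapT => nAx; apply: nx => Ox.
have := NA x; rewrite /= => Nx.
have Nx0 : m1 (ysection N x) = 0%E.
  by apply: contrapT => h; apply: nAx; split => //; exact: Nx.
exists (ysection N x `&` boundary Omega); split.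
- by apply: measurableI => //; exact: measurable_ysection.
- exact: Nx0.
move=> z bz nN; apply/andP; split; rewrite leNgt; apply/negP => lt1; apply: nN.
  by split=> //; rewrite /ysection/= inE; left.
by split=> //; rewrite /ysection/= inE; right.
Qed.

(** Sections of sets measurable in the product are measurable for every [x], not merely almost every
    one. *)
Lemma measurable_normal_derivative_section (x : 'rV[R]_n) : Omega x ->
  measurable_fun (boundary Omega : set (surfaceType R n)) (fun z => D z x).
Proof.
move=> Ox mb Y mY.
have := normal_derivative_measurable normalD measurable_domain mY.
move=> /(@measurable_ysection _ _ (surfaceType R n) (lebesgueType R n) _ x).
rewrite (_ : ysection _ x = boundary Omega `&` (fun z => D z x) @^-1` Y)//.
apply/seteqP; split=> [z|z [bz Dz]]; rewrite /ysection/= inE.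
  by move=> [[bz _] ?].
by split.
Qed.

End PoissonBounds.

Theorem corollary4p3 (R : realType) (n : nat) (Omega : set 'rV[R]_n)
    (s gamma : R) (G D : 'rV[R]_n -> 'rV[R]_n -> R) :
  (1 <= n)%N ->
  bounded_domain Omega ->
  C11_boundary Omega ->
  0 < s <= 1 ->
  0 < gamma <= 1 ->
  2 * s <= n%:R ->
  green_kernel Omega s gamma G ->
  normal_derivative Omega gamma G D ->
  ae_comparable_on Omega (u_star Omega D) (u_star_rate Omega s gamma).
Proof.
move=> n1 dO C11O _ /andP[gamma0 _] sn greenG normalD.
have [C C1 CD] := ae_normal_derivative_bounds n1 dO C11O greenG normalD.
have [C' C'0 CI] := surface_kernel_integral n1 dO C11O gamma0 sn.
have C0 : 0 < C by lra.
exists (C * C'); first by rewrite mulr_gt0.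
have aeF := ae_filter_ringOfSetsType (lebesgue_n R n).
apply: filterS CD => x CD Ox; have [N [mN N0 DN]] := CD Ox.
have mb : measurable (boundary Omega : set (surfaceType R n)).
  exact/closed_hausdorff_measurable/closed_boundary.
pose ker (z : 'rV[R]_n) := bdist Omega x `^ gamma *
  enorm (x - z) `^ (- (n%:R - 2 * s + 2 * gamma)).
have ker0 z : 0 <= ker z by apply: mulr_ge0; exact: powR_ge0.
have mker : measurable_fun (boundary Omega : set (surfaceType R n)) ker.
  exact: measurable_surface_kernel.
have mcker c : measurable_fun (boundary Omega : set (surfaceType R n))
    (fun z => c * ker z).
  exact: measurable_funM (measurable_cst _) mker.
have Cinv : 0 <= C^-1 by rewrite invr_ge0 ltW.
have kerlo z : boundary Omega z -> 0 <= C^-1 * ker z <= C * ker z.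
  move=> _; apply/andP; split; first exact: mulr_ge0.
  apply: ler_wpM2r => //; apply: (@le_trans _ _ 1) => //.
  by rewrite invf_le1.
have mD := measurable_normal_derivative_section dO normalD Ox.
have /andP[lo hi] := integral_ae_bounds mb mD (mcker C^-1) (mcker C) kerlo mN
  N0 DN.
have /andP[Ilo Ihi] := CI x Ox.
rewrite /u_star; apply/andP; split.
  apply: le_trans lo.
  rewrite (integral_EFinM (surface_measure R n) mb mker
    (fun z _ => ker0 z) Cinv).
  rewrite invfM -mulrA EFinM; apply: lee_wpmul2l; first by rewrite lee_fin.
  exact: Ilo.
apply: (le_trans hi).
rewrite (integral_EFinM (surface_measure R n) mb mker
  (fun z _ => ker0 z) (ltW C0)).
rewrite -mulrA EFinM; apply: lee_wpmul2l; first by rewrite lee_fin ltW.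
exact: Ihi.
Qed.
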